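(* Let $d \geq 2$ and $0<p<1$, and consider the Gilbert--Steiner problem in $\mathbb{R}^d$ with cost function $c(x)=x^p$. (1) If $d=2$ or $p<1/2$, then every branching point of every solution (minimal flow) has degree exactly three. (2) If $p \geq 1/2$, then there exist data $\mu^+,\mu^-$ for which some solution consists of $d+1$ segments, all adjacent to the same branching point.
   Context: Let $\mu^+,\mu^-$ be finite measures on $\mathbb{R}^d$ (with the Euclidean distance $\rho$) with finite supports and $\mu^+(\mathbb{R}^d)=\mu^-(\mathbb{R}^d)$. A $(\mu^+,\mu^-)$-flow consists of a finite set $V\subset\mathbb{R}^d$ of vertices containing the support of $\mu^+-\mu^-$, a finite set $E$ of unordered pairs $\{x,y\}\subset V$ (edges), and for each edge non-zero reals $m(x,y)=-m(y,x)$, such that $\mu^+-\mu^-=\sum_{\{x,y\}\in E} m(x,y)(\delta_y-\delta_x)$. Its Gilbert functional is $\sum_{\{x,y\}\in E} c(|m(x,y)|)\,\rho(x,y)$. The Gilbert--Steiner problem asks for a $(\mu^+,\mu^-)$-flow minimizing the Gilbert functional with $c(x)=x^p$, $0<p<1$; a minimizer is called a solution or minimal flow. Vertices in $\operatorname{supp}\mu^+\cup\operatorname{supp}\mu^-$ are terminals; other vertices are branching points. Branching points of degree 2 are formally allowed but are understood to be eliminated (by merging their two edges), so degrees of branching points are counted in solutions without degree-2 branching points. *)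

(* Defs.v *)
From HB Require Import structures.
From mathcomp Require Import all_boot all_order all_algebra.
From mathcomp Require Import all_classical all_reals all_analysis.
Set Implicit Arguments. Unset Strict Implicit. Unset Printing Implicit Defensive.
Import Order.TTheory GRing.Theory Num.Theory.
Local Open Scope ring_scope.

Section GS.
Variables (R : realType) (d : nat).

Definition gpoint := 'rV[R]_d.

Definition edist (x y : gpoint) : R :=
  Num.sqrt (\sum_(i < d) (x ord0 i - y ord0 i) ^+ 2).

Definition fin_measure (mu : gpoint -> R) : Prop :=
  (forall x, 0 <= mu x) /\ exists s : seq gpoint, forall x, x \notin s -> mu x = 0.

Definition gs_data (mup mum : gpoint -> R) : Prop :=
  fin_measure mup /\ fin_measure mum /\
  exists s : seq gpoint, [/\ uniq s,
    (forall x, x \notin s -> mup x = 0 /\ mum x = 0) &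
    \sum_(x <- s) mup x = \sum_(x <- s) mum x].

(* A flow: a finite list of vertices and a list of edges.  An edge (x, y, m)
   stands for the unordered pair {x, y} with m(x,y) = m, m(y,x) = -m. *)
Record flow := Flow { fV : seq gpoint; fE : seq (gpoint * gpoint * R) }.

Definition same_pair (e f : gpoint * gpoint * R) : bool :=
  ((e.1.1 == f.1.1) && (e.1.2 == f.1.2)) || ((e.1.1 == f.1.2) && (e.1.2 == f.1.1)).

Definition is_flow (mup mum : gpoint -> R) (F : flow) : Prop :=
  [/\ uniq (fV F),
      (forall e, e \in fE F ->
         [/\ e.1.1 \in fV F, e.1.2 \in fV F, e.1.1 != e.1.2 & e.2 != 0]),
      pairwise (fun e f => ~~ same_pair e f) (fE F),
      (forall z, mup z - mum z != 0 -> z \in fV F) &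
      (forall z, mup z - mum z =
         \sum_(e <- fE F) e.2 * ((z == e.1.2)%:R - (z == e.1.1)%:R))].

Definition gilbert (p : R) (F : flow) : R :=
  \sum_(e <- fE F) (`|e.2| `^ p) * edist e.1.1 e.1.2.

Definition minimal_flow (p : R) (mup mum : gpoint -> R) (F : flow) : Prop :=
  is_flow mup mum F /\
  forall G, is_flow mup mum G -> gilbert p F <= gilbert p G.

Definition terminal (mup mum : gpoint -> R) (v : gpoint) : bool :=
  (mup v != 0) || (mum v != 0).

Definition branching (mup mum : gpoint -> R) (F : flow) (v : gpoint) : bool :=
  (v \in fV F) && ~~ terminal mup mum v.

Definition incident (v : gpoint) (e : gpoint * gpoint * R) : bool :=
  (e.1.1 == v) || (e.1.2 == v).

Definition degree (F : flow) (v : gpoint) : nat := count (incident v) (fE F).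

(* the paper's convention: degree-2 branching points have been eliminated *)
Definition no_deg2_branching (mup mum : gpoint -> R) (F : flow) : Prop :=
  forall v, branching mup mum F v -> degree F v <> 2%N.

End GS.

(* Main.v *)
Require Import Defs.
From HB Require Import structures.
From mathcomp Require Import all_boot all_order all_algebra.
From mathcomp Require Import all_classical all_reals all_analysis.
From mathcomp Require Import ring lra zify.
Set Implicit Arguments. Unset Strict Implicit. Unset Printing Implicit Defensive.
Import Order.TTheory GRing.Theory Num.Theory.
Import numFieldNormedType.Exports.
Local Open Scope ring_scope.

(* Let the edges at a branching point carry outflows m_e and let w_e be |m_e|^p
   times the unit direction of e.  Splitting off a group I of edges and moving
   its end by a small multiple of w_I, the sum of the w_e over I, shows that in a
   minimal flow |w_I| <= |m_I|^p, with equality when I is a single edge; both the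
   m_e and the w_e have sum 0.  Put f(t) = |t|^(2p).

   If p < 1/2, then summing |w_i + w_j|^2 <= f(m_i + m_j) over the pairs of n >= 4
   edges gives (n - 2) sum f(m_i) <= sum f(m_i + m_j), which contradicts a
   generalized Hlawka inequality for f.

   If d = 2, sort the edges by angle.  By Schoenberg, f(x - y) is the squared
   distance of an embedding of the line in a Hilbert space, so the partial sums
   of the m_e are the vertices of a closed polygon there with sides h_e, |h_e| =
   |w_e|.  Consecutive sides satisfy <h_e, h_e'> >= <w_e, w_e'>, and the
   triangle inequality for angles extends this to all pairs since the plane
   angles add up to 2 pi.  As both polygons are closed, all these inequalities
   are equalities, so that the h_e lie in a plane; but the embedding sends any
   four distinct points to affinely independent ones.

   For p >= 1/2, take d unit vectors w_i with common inner products such that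
   |w_1 + ... + w_d| = d^p, send mass 1 to every w_i and take mass d from
   - (w_1 + ... + w_d).  Then |sum t_i w_i| <= (sum t_i)^p for 0 <= t_i <= 1, and
   decomposing a competitor into d flows with one sink each, the w_i calibrate
   the star. *)

(** * Powers and conditionally negative definite kernels *)

Section PowerKernel.
Context {R : realType}.
Implicit Types (q w s t p : R).

Lemma expR_itv t : 0 <= t -> 0 <= 1 - expR (- t) <= Num.min 1 t.
Proof.
move=> t0; rewrite subr_ge0 -[leRHS]expR0 ler_expR oppr_le0 t0 /=.
rewrite le_min gerBl expR_ge0 /= lerBlDr.
by have := expR_ge1Dx (- t); lra.
Qed.

(* [F t] is the sum of [w ^ (- k) * (1 - expR (- q ^ k * t))] over all integers
   [k], a discrete version of the integral representing [t `^ p], [w = q `^ p];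
   [sum_powR_le0] lets [q] tend to 1. *)
Lemma quasi_power (I : finType) q w (kap u : I -> R) : 1 < w < q ->
    (forall i, 0 <= u i) -> \sum_i kap i = 0 ->
    (forall s, 0 <= s -> 0 <= \sum_i kap i * expR (- (s * u i))) ->
  exists F : R -> R,
    [/\ forall t, 0 <= t -> F (q * t) = w * F t,
        forall x y, 0 <= x <= y -> F x <= F y,
        F 0 = 0, 0 < F 1 & \sum_i kap i * F (u i) <= 0].
Proof.
case/andP=> w1 wq u0 kap0 kapE.
have w0 : 0 < w by lra.
have q0 : 0 < q by lra.
(* [A] holds the terms of index [k >= 0] and [B] those of index [- k.+1]. They are dominated by
   geometric series of ratios [w^-1] and [w / q], both less than 1. *)
pose A t k := (w ^+ k)^-1 * (1 - expR (- (q ^+ k * t))).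
pose B t k := w ^+ k.+1 * (1 - expR (- ((q ^+ k.+1)^-1 * t))).
have A0 t k : 0 <= t -> 0 <= A t k.
  move=> t0; rewrite mulr_ge0 ?invr_ge0 ?exprn_ge0 ?(ltW w0) ?(ltW q0) //.
  have : 0 <= q ^+ k * t by rewrite mulr_ge0 ?exprn_ge0 ?(ltW w0) ?(ltW q0).
  by case/expR_itv/andP.
have B0 t k : 0 <= t -> 0 <= B t k.
  move=> t0; rewrite mulr_ge0 ?exprn_ge0 ?(ltW w0) ?(ltW q0) //.
  have : 0 <= (q ^+ k.+1)^-1 * t by rewrite mulr_ge0 ?invr_ge0 ?exprn_ge0 ?(ltW w0) ?(ltW q0).
  by case/expR_itv/andP.
have cA t : 0 <= t -> cvgn (series (A t)).
  move=> t0; apply: (@series_le_cvg _ (A t) (geometric 1 w^-1)).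
  - by move=> k; exact: A0.
  - by move=> k; apply: geometric_ge0; rewrite ?invr_ge0 ?(ltW w0) ?(ltW q0).
  - move=> k; rewrite /A /geometric /= mul1r exprVn ler_piMr //.
    by rewrite invr_ge0 exprn_ge0 ?(ltW w0) ?(ltW q0).
  - apply: is_cvg_geometric_series.
    by rewrite ger0_norm ?invr_ge0 ?(ltW w0) ?(ltW q0) // invf_lt1.
have cB t : 0 <= t -> cvgn (series (B t)).
  move=> t0; apply: (@series_le_cvg _ (B t) (geometric (w / q * t) (w / q))).
  - by move=> k; exact: B0.
  - by move=> k; apply: geometric_ge0; rewrite ?mulr_ge0 ?invr_ge0 ?(ltW w0) ?(ltW q0).
  - move=> k; rewrite /B /geometric /=.
    have h : 0 <= (q ^+ k.+1)^-1 * t by rewrite mulr_ge0 ?invr_ge0 ?exprn_ge0 ?(ltW w0) ?(ltW q0).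
    rewrite (_ : w / q * t * _ = w ^+ k.+1 * ((q ^+ k.+1)^-1 * t)); last first.
      rewrite expr_div_n !exprS; field.
      by rewrite expf_neq0 gt_eqF.
    rewrite ler_pM2l ?exprn_gt0 //.
    by case/expR_itv/andP: h => _; rewrite le_min => /andP[].
  - apply: is_cvg_geometric_series.
    rewrite ger0_norm ?mulr_ge0 ?invr_ge0 ?(ltW w0) ?(ltW q0) // ltr_pdivrMr //; lra.
exists (fun t => limn (series (A t)) + limn (series (B t))); split.
- move=> t t0.
  have qt0 : 0 <= q * t by rewrite mulr_ge0 ?(ltW w0) ?(ltW q0).
  (* Replacing [t] by [q * t] shifts the index by one and brings out a factor [w]; [EB0] treats the
     term that crosses from one half of the series to the other. *)
  have EA k : A (q * t) k = w * A t k.+1.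
    rewrite /A (_ : q ^+ k * (q * t) = q ^+ k.+1 * t); last by rewrite exprS; ring.
    by rewrite [w ^+ k.+1]exprS invfM -mulrA mulVKf ?gt_eqF.
  have EB k : B (q * t) k.+1 = w * B t k.
    rewrite /B [w ^+ k.+2]exprS -[in LHS]mulrA; congr (_ * (_ * (1 - expR (- _)))).
    by rewrite [q ^+ k.+2]exprS invfM; field; rewrite expf_neq0 ?gt_eqF.
  have EB0 : B (q * t) 0%N = w * A t 0%N.
    by rewrite /A /B !expr1 !expr0 invr1 !mul1r mulKf ?gt_eqF.
  have SA n : series (A (q * t)) n = w * (series (A t) n.+1 - A t 0%N).
    rewrite /series /= big_nat_recl // [A t 0%N + _]addrC addrK mulr_sumr.
    by apply: eq_bigr => k _; exact: EA.
  have SB n : series (B (q * t)) n.+1 = w * (series (B t) n + A t 0%N).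
    rewrite /series /= big_nat_recl // mulrDr addrC EB0 mulr_sumr.
    by congr (_ + _); apply: eq_bigr => k _; exact: EB.
  have LA : limn (series (A (q * t))) = w * (limn (series (A t)) - A t 0%N).
    apply/cvg_lim => //; rewrite (_ : series _ = fun n => w * (series (A t) n.+1 - A t 0%N));
      last exact/funext.
    apply: cvgMr; apply: cvgB; last exact: cvg_cst.
    by have := cA t t0; rewrite -cvg_shiftS.
  have LB : limn (series (B (q * t))) = w * (limn (series (B t)) + A t 0%N).
    apply/cvg_lim => //; rewrite -cvg_shiftS /=.
    rewrite (_ : (fun n => _) = fun n => w * (series (B t) n + A t 0%N)); last exact/funext.
    by apply: cvgMr; apply: cvgD; [exact: cB|exact: cvg_cst].
  by rewrite LA LB; ring.
- move=> x y /andP[x0 xy].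
  have y0 : 0 <= y by lra.
  apply: lerD.
    apply: ler_lim (cA x x0) (cA y y0) _.
    apply: nearW => n; apply: ler_sum => k _; rewrite /A.
    by rewrite ler_pM2l ?invr_gt0 ?exprn_gt0 // lerB // ler_expR lerN2 ler_pM2l ?exprn_gt0.
  apply: ler_lim (cB x x0) (cB y y0) _.
  apply: nearW => n; apply: ler_sum => k _; rewrite /B.
  by rewrite ler_pM2l ?exprn_gt0 // lerB // ler_expR lerN2 ler_pM2l ?invr_gt0 ?exprn_gt0.
- have EA n : series (A 0) n = 0.
    by rewrite /series /= big1 // => k _; rewrite /A mulr0 oppr0 expR0 subrr mulr0.
  have EB n : series (B 0) n = 0.
    by rewrite /series /= big1 // => k _; rewrite /B mulr0 oppr0 expR0 subrr mulr0.
  rewrite (_ : series (A 0) = fun=> 0); last exact/funext.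
  rewrite (_ : series (B 0) = fun=> 0); last exact/funext.
  by rewrite !lim_cst // addr0.
- apply: ltr_pwDl.
    have A1 : 0 < A 1 0%N.
      by rewrite /A !expr0 invr1 !mul1r subr_gt0 -[ltRHS]expR0 ltr_expR oppr_lt0.
    apply: (lt_le_trans A1); apply: limr_ge; first exact: cA.
    exists 1%N => // n /= n1; rewrite -(subnKC n1) add1n /series /= big_nat_recl // lerDl.
    by apply: sumr_ge0 => k _; exact: A0.
  apply: limr_ge; first exact: cB.
  by apply: nearW => n; apply: sumr_ge0 => k _; exact: B0.
(* Each term alone has a nonpositive sum: the constant 1 contributes nothing since the [kap i] add
   up to 0, and the exponentials have a nonnegative sum. *)
- have key c s : 0 <= c -> 0 <= s ->
      \sum_i kap i * (c * (1 - expR (- (s * u i)))) <= 0.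
    move=> c0 s0.
    have -> : \sum_i kap i * (c * (1 - expR (- (s * u i)))) =
       c * (\sum_i kap i - \sum_i kap i * expR (- (s * u i))).
      by rewrite -sumrB mulr_sumr; apply: eq_bigr => i _; ring.
    by rewrite kap0 sub0r mulrN oppr_le0 mulr_ge0 ?kapE.
  have key2 n : \sum_i kap i * (series (A (u i)) n + series (B (u i)) n) <= 0.
    have -> : \sum_i kap i * (series (A (u i)) n + series (B (u i)) n) =
        \sum_(0 <= k < n) \sum_i kap i * A (u i) k +
        \sum_(0 <= k < n) \sum_i kap i * B (u i) k.
      rewrite exchange_big /= [X in _ + X]exchange_big /= -big_split /=.
      by apply: eq_bigr => i _; rewrite mulrDr /series /= !mulr_sumr.
    rewrite -oppr_ge0 opprD; apply: addr_ge0; rewrite oppr_ge0;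
      apply: sumr_le0 => k _; apply: key;
      by rewrite ?invr_ge0 exprn_ge0 ?(ltW w0) ?(ltW q0).
  have cvF : (\sum_i kap i * (series (A (u i)) n + series (B (u i)) n) @[n --> \oo] -->
      \sum_i kap i * (limn (series (A (u i))) + limn (series (B (u i)))))%classic.
    apply: cvg_big => [|i _]; first exact: add_continuous.
    apply: cvgMr; apply: cvgD; [exact: cA|exact: cB].
  rewrite -(cvg_lim (@norm_hausdorff _ _) cvF); apply: limr_le; first by apply: cvgP cvF.
  by apply: nearW.
Qed.

(** With [w = 1 + e] and [q = w ^ (1 / p)], the function [F] of [quasi_power], normalised by [F 1],
    agrees with t^p up to a factor [1 + e], and [e] is arbitrary. *)
Lemma sum_powR_le0 (I : finType) p (kap u : I -> R) : 0 < p < 1 ->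
    (forall i, 0 <= u i) -> \sum_i kap i = 0 ->
    (forall s, 0 <= s -> 0 <= \sum_i kap i * expR (- (s * u i))) ->
  \sum_i kap i * u i `^ p <= 0.
Proof.
case/andP=> p0 p1 u0 kap0 kapE.
suff H e : 0 < e -> \sum_i kap i * u i `^ p <= e * \sum_i `|kap i| * u i `^ p.
  set C := \sum_i `|kap i| * u i `^ p in H.
  have C0 : 0 <= C by apply: sumr_ge0 => i _; rewrite mulr_ge0 ?powR_ge0.
  rewrite leNgt; apply/negP => pos.
  (* If S is the sum, assumed positive, then e = S / (2 C + 1) would give 2 C + 1 <= C. *)
  have := H (\sum_i kap i * u i `^ p / (C + C + 1)).
  rewrite -mulr_suml ltr_pdivlMr; last lra.
  rewrite mul0r => /(_ pos); rewrite mulrAC ler_pdivlMr; last lra.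
  by rewrite ler_pM2l //; lra.
move=> e0; pose w := 1 + e; pose q := w `^ p^-1.
have w1 : 1 < w by rewrite /w; lra.
have w0 : 0 < w by lra.
have wq : w < q.
  rewrite -[ltLHS]powRr1 ?ltW // /q /powR gt_eqF // ltr_expR ltr_pM2r ?ln_gt0 //.
  by rewrite invf_gt1.
have q1 : 1 < q by lra.
have q0 : 0 < q by lra.
have qp : q `^ p = w by rewrite -powRrM mulVf ?gt_eqF // powRr1 // ltW.
have wE : w = 1 + e by [].
clearbody q; clearbody w.
have [|F [Fq Fmono F0 F1 Fsum]] := @quasi_power I q w kap u _ u0 kap0 kapE; first by rewrite w1 wq.
have Fn n t : 0 <= t -> F (q ^+ n * t) = w ^+ n * F t.
  elim: n => [|n IH] t0; first by rewrite !expr0 !mul1r.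
  by rewrite exprS -mulrA Fq ?IH ?exprS ?mulrA // mulr_ge0 // exprn_ge0 // ltW.
have Fz (z : int) : F (q ^ z) = w ^ z * F 1.
  case: z => n; first by rewrite -exprnP -[q ^+ n]mulr1 Fn.
  rewrite NegzE -!exprnN.
  have := Fn n.+1 (q ^- n.+1); rewrite mulfV; last by rewrite expf_neq0 ?gt_eqF.
  rewrite invr_ge0 exprn_ge0 ?(ltW q0) // => /(_ isT) ->.
  by rewrite mulKf // expf_neq0 ?gt_eqF.
(* For t between q^z and q^(z + 1), monotonicity puts both t^p and [F t / F 1] between w^z and w^(z
   + 1). *)
have bnd t : 0 <= t -> t `^ p <= F t / F 1 + e * t `^ p /\ F t / F 1 <= (1 + e) * t `^ p.
  rewrite le_eqVlt => /predU1P[<-|t0].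
    by rewrite F0 powR0 ?gt_eqF // mul0r !mulr0 addr0.
  pose z := Num.floor (ln t / ln q).
  have lnq : 0 < ln q by rewrite ln_gt0.
  have tE : t = q `^ (ln t / ln q).
    by rewrite /powR gt_eqF // divfK ?gt_eqF // lnK.
  have /andP[z1 z2] := floor_itv (ln t / ln q).
  have qz : q ^ z <= t.
    by rewrite [leRHS]tE -powR_intmul ?(ltW q0) //; exact: (ler_powR (ltW q1) z1).
  have tz : t <= q ^ (z + 1).
    by rewrite [leLHS]tE -powR_intmul ?(ltW q0) //; exact: (ler_powR (ltW q1) (ltW z2)).
  have wz (y : int) : (q ^ y) `^ p = w ^ y.
    by rewrite -(powR_intmul y (ltW q0)) powRAC qp (powR_intmul y (ltW w0)).
  have qz0 y : 0 < q ^ y by rewrite exprz_gt0.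
  have wz0 : 0 < w ^ z by rewrite exprz_gt0.
  have wz1 : w ^ (z + 1) = w * w ^ z by rewrite addrC expfzDr ?gt_eqF // expr1z.
  have P1 : w ^ z <= t `^ p.
    by rewrite -wz; apply: ge0_ler_powR => //; rewrite ?nnegrE ltW.
  have P2 : t `^ p <= w * w ^ z.
    by rewrite -wz1 -wz; apply: ge0_ler_powR => //; rewrite ?nnegrE ltW.
  have Q1 : w ^ z <= F t / F 1.
    by rewrite ler_pdivlMr // -Fz; apply: Fmono; rewrite ltW.
  have Q2 : F t / F 1 <= w * w ^ z.
    by rewrite ler_pdivrMr // -wz1 -Fz; apply: Fmono; rewrite ltW.
  have P3 : e * w ^ z <= e * t `^ p by rewrite ler_pM2l.
  move: {qz tz wz qz0 wz0 wz1} (w ^ z) (t `^ p) (F t / F 1) P1 P2 Q1 Q2 P3 => a b f.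
  by rewrite wE !mulrDl !mul1r => *; split; lra.
have -> : \sum_i kap i * u i `^ p =
    \sum_i kap i * F (u i) / F 1 + \sum_i kap i * (u i `^ p - F (u i) / F 1).
  by rewrite -big_split; apply: eq_bigr => i _ /=; ring.
rewrite -mulr_suml -[leRHS]add0r; apply: lerD.
  by rewrite pmulr_lle0 // invr_gt0.
rewrite mulr_sumr; apply: ler_sum => i _.
rewrite (le_trans (ler_norm _)) // normrM mulrCA ler_wpM2l // ler_norml.
by have [] := bnd _ (u0 i); lra.
Qed.

Lemma powRD_le p t c : 0 < p < 1 -> 0 < t -> 0 <= c ->
  (t + c) `^ p <= t `^ p + c * (t `^ p / t).
Proof.
case/andP=> p0 p1 t0 c0.
have -> : t + c = t * (1 + c / t) by field; rewrite gt_eqF.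
have c1 : 0 <= c / t by rewrite divr_ge0 // ltW.
rewrite powRM; [|exact: ltW|by rewrite addr_ge0].
apply: (@le_trans _ _ (t `^ p * (1 + c / t))).
  by rewrite ler_pM2l ?powR_gt0 //; apply: ler1_powR; [rewrite lerDl|exact: ltW].
by rewrite mulrDr mulr1 lerD2l mulrCA.
Qed.

(* Shifting all [u i] by [c] costs [O(c)] at the positive ones, but contributes
   [c `^ p], of larger order, at the vanishing ones. *)
Lemma sum_powR_lt0 (I : finType) p (kap u : I -> R) : 0 < p < 1 ->
    (forall i, 0 <= u i) -> \sum_i kap i = 0 ->
    (forall s, 0 <= s -> 0 <= \sum_i kap i * expR (- (s * u i))) ->
    0 < \sum_(i | u i == 0) kap i ->
  \sum_i kap i * u i `^ p < 0.
Proof.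
move=> p01 u0 kap0 kapE K0; have /andP[p0 p1] := p01.
set K := \sum_(i | u i == 0) kap i in K0.
pose C := \sum_i `|kap i| * (u i `^ p / u i).
have C0 : 0 <= C.
  by apply: sumr_ge0 => i _; rewrite mulr_ge0 // divr_ge0 ?powR_ge0.
have key c : 0 < c -> \sum_i kap i * u i `^ p <= c * C - c `^ p * K.
  move=> c0.
  (* The shift by [c] multiplies the exponential sum by a positive factor, so its sign is kept. *)
  have S : \sum_i kap i * (u i + c) `^ p <= 0.
    apply: sum_powR_le0 => // [i|s s0]; first by rewrite addr_ge0 // ltW.
    under eq_bigr do rewrite mulrDr opprD expRD mulrA.
    by rewrite -mulr_suml mulr_ge0 ?expR_ge0 // kapE.
  rewrite -subr_ge0; apply: le_trans (_ : - \sum_i kap i * (u i + c) `^ p <= _).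
    by rewrite oppr_ge0.
  rewrite -subr_ge0.
  have -> : c * C - c `^ p * K - \sum_i kap i * u i `^ p -
      (- \sum_i kap i * (u i + c) `^ p) =
      \sum_i (c * (`|kap i| * (u i `^ p / u i)) - (if u i == 0 then c `^ p * kap i else 0)
       - kap i * u i `^ p + kap i * (u i + c) `^ p).
    rewrite opprK /C /K !mulr_sumr [X in _ - X - _]big_mkcond.
    by rewrite -!sumrB -big_split.
  apply: sumr_ge0 => i _; case: eqVneq => [->|un0].
    by rewrite powR0 ?gt_eqF // mul0r !mulr0 !add0r subr0 mulrC addNr.
  rewrite subr0 mulrCA.
  have ui : 0 < u i by rewrite lt_neqAle eq_sym un0 u0.
  have h1 := powRD_le p01 ui (ltW c0).
  have h2 : u i `^ p <= (u i + c) `^ p.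
    by apply: ge0_ler_powR; rewrite ?nnegrE ?addr_ge0 ?lerDl ?(ltW c0) ?(ltW p0) ?(ltW ui).
  have : `|kap i * ((u i + c) `^ p - u i `^ p)| <= `|kap i| * (c * (u i `^ p / u i)).
    by rewrite normrM ler_wpM2l // ger0_norm; lra.
  by rewrite ler_norml mulrBr => /andP[]; lra.
(* [c] solves c = r c^p, so that c C - c^p K = c^p (r C - K), which is negative because r C < K. *)
pose r := K / (C + 1); pose c := r `^ (1 - p)^-1.
have r0 : 0 < r by rewrite divr_gt0 // ltr_wpDl.
have c0 : 0 < c by rewrite powR_gt0.
have cr : c = c `^ p * r.
  rewrite -[r in RHS]powRr1 ?(ltW r0) // -(@mulVf _ (1 - p)); last lra.
  rewrite powRrM -/c -powRD ?subrKC ?powRr1 ?(ltW c0) //.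
  by rewrite gt_eqF ?implybT.
apply: le_lt_trans (key c c0) _.
rewrite {1}cr -mulrA -mulrBr pmulr_rlt0 ?powR_gt0 // subr_lt0.
by rewrite /r mulrAC ltr_pdivrMr ?ltr_wpDl // ltr_pM2l // ltrDl.
Qed.

End PowerKernel.

(** * Gaussian kernels and the kernel |x - y|^(2p) on the line *)

Section DistanceKernel.
Context {R : realType} (I : finType).
Implicit Types (l x : I -> R) (s p : R).

(** The mixed factor [expR (y i j)] is expanded into its power series; the term of degree k
    contributes a nonnegative multiple of the square of [\sum_i c i * x i ^+ k]. *)
Lemma gauss_kernel_ge0 l x s : 0 <= s ->
  0 <= \sum_i \sum_j l i * l j * expR (- (s * (x i - x j) ^+ 2)).
Proof.
move=> s0; pose c i := l i * expR (- (s * x i ^+ 2)).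
pose y i j := 2 * s * (x i * x j).
have -> : \sum_i \sum_j l i * l j * expR (- (s * (x i - x j) ^+ 2)) =
    \sum_i \sum_j c i * c j * expR (y i j).
  apply: eq_bigr => i _; apply: eq_bigr => j _; rewrite /c mulrACA -[RHS]mulrA -!expRD.
  by congr (_ * expR _); rewrite /y; ring.
have pos n : 0 <= \sum_i \sum_j c i * c j * series (exp_coeff (y i j)) n.
  rewrite (_ : \sum_i _ =
      \sum_(0 <= k < n) (2 * s) ^+ k / k`!%:R * (\sum_i c i * x i ^+ k) ^+ 2).
    apply: sumr_ge0 => k _; rewrite mulr_ge0 ?sqr_ge0 // divr_ge0 //.
    by rewrite exprn_ge0 // mulr_ge0.
  under eq_bigr do under eq_bigr do rewrite /series /= mulr_sumr.
  under eq_bigr do rewrite exchange_big /=.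
  rewrite exchange_big /=; apply: eq_bigr => k _.
  rewrite expr2 mulr_suml mulr_sumr; apply: eq_bigr => i _.
  rewrite mulr_sumr mulr_sumr; apply: eq_bigr => j _.
  by rewrite /exp_coeff /= /y !exprMn; ring.
have cv : (\sum_i \sum_j c i * c j * series (exp_coeff (y i j)) n @[n --> \oo] -->
    \sum_i \sum_j c i * c j * expR (y i j))%classic.
  apply: cvg_big => [|i _]; first exact: add_continuous.
  apply: cvg_big => [|j _]; first exact: add_continuous.
  by apply: cvgMr; exact: is_cvg_series_exp_coeff.
rewrite -(cvg_lim (@norm_hausdorff _ _) cv); apply: limr_ge; first by apply: cvgP cv.
exact: nearW.
Qed.

Lemma sum_pair (f : I -> I -> R) : \sum_(k : I * I) f k.1 k.2 = \sum_i \sum_j f i j.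
Proof. by rewrite pair_bigA. Qed.

Lemma sum_prod0 l : \sum_i l i = 0 -> \sum_(k : I * I) l k.1 * l k.2 = 0.
Proof.
move=> l0; rewrite (sum_pair (fun i j => l i * l j)).
by under eq_bigr do rewrite -mulr_sumr l0 mulr0; rewrite big1.
Qed.

(** Schoenberg's theorem for the kernel |x - y|^(2p), obtained from the Gaussian kernels. It stands
    in for an embedding into a Hilbert space with these squared distances. *)
Lemma sqdist_powR_le0 p l x : 0 < p < 1 -> \sum_i l i = 0 ->
  \sum_i \sum_j l i * l j * ((x i - x j) ^+ 2) `^ p <= 0.
Proof.
move=> p01 l0; rewrite -(sum_pair (fun i j => l i * l j * ((x i - x j) ^+ 2) `^ p)).
apply: (sum_powR_le0 (kap := fun k => l k.1 * l k.2) (u := fun k => (x k.1 - x k.2) ^+ 2)) => //.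
- by move=> k; exact: sqr_ge0.
- exact: sum_prod0.
- move=> s s0.
  rewrite (sum_pair (fun i j => l i * l j * expR (- (s * (x i - x j) ^+ 2)))).
  exact: gauss_kernel_ge0.
Qed.

(** The pairs at distance 0 are the diagonal ones, whose weights [l i ^+ 2] have a positive sum.
    This expresses the affine independence of distinct embedded points. *)
Lemma sqdist_powR_lt0 p l x : 0 < p < 1 -> injective x -> \sum_i l i = 0 ->
  (exists i, l i != 0) -> \sum_i \sum_j l i * l j * ((x i - x j) ^+ 2) `^ p < 0.
Proof.
move=> p01 xI l0 [i0 li0].
rewrite -(sum_pair (fun i j => l i * l j * ((x i - x j) ^+ 2) `^ p)).
apply: (sum_powR_lt0 (kap := fun k => l k.1 * l k.2) (u := fun k => (x k.1 - x k.2) ^+ 2)) => //.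
- by move=> k; exact: sqr_ge0.
- exact: sum_prod0.
- move=> s s0.
  rewrite (sum_pair (fun i j => l i * l j * expR (- (s * (x i - x j) ^+ 2)))).
  exact: gauss_kernel_ge0.
- rewrite (eq_bigl (fun k : I * I => k.1 == k.2)); last first.
    by move=> k; rewrite sqrf_eq0 subr_eq0 (inj_eq xI).
  rewrite big_mkcond /= (sum_pair (fun i j => if i == j then l i * l j else 0)).
  under eq_bigr do rewrite -big_mkcond /= (eq_bigl (pred1 _) _ (fun j => eq_sym _ _)) big_pred1_eq.
  rewrite (bigD1 i0) //= ltr_pwDl ?sumr_ge0 //.
    by rewrite -expr2 exprn_even_gt0.
  by move=> i _; rewrite -expr2 sqr_ge0.
Qed.

End DistanceKernel.

(** * Euclidean inner product and norm *)

Section EuclideanSpace.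
Context {R : realType} {d : nat}.
Implicit Types (u v w : 'rV[R]_d) (a : R).

Definition dot u v : R := \sum_(i < d) u ord0 i * v ord0 i.
Definition enorm u : R := Num.sqrt (dot u u).

Lemma dotC u v : dot u v = dot v u.
Proof. by apply: eq_bigr => i _; rewrite mulrC. Qed.

Lemma dotDl u v w : dot (u + v) w = dot u w + dot v w.
Proof. by rewrite -big_split; apply: eq_bigr => i _; rewrite mxE mulrDl. Qed.

Lemma dotDr u v w : dot w (u + v) = dot w u + dot w v.
Proof. by rewrite dotC dotDl !(dotC w). Qed.

Lemma dotZl a u v : dot (a *: u) v = a * dot u v.
Proof. by rewrite mulr_sumr; apply: eq_bigr => i _; rewrite mxE mulrA. Qed.

Lemma dotZr a u v : dot u (a *: v) = a * dot u v.
Proof. by rewrite dotC dotZl dotC. Qed.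

Lemma dotNl u v : dot (- u) v = - dot u v.
Proof. by rewrite -scaleN1r dotZl mulN1r. Qed.

Lemma dotNr u v : dot u (- v) = - dot u v.
Proof. by rewrite dotC dotNl dotC. Qed.

Lemma dotBl u v w : dot (u - v) w = dot u w - dot v w.
Proof. by rewrite dotDl dotNl. Qed.

Lemma dotBr u v w : dot w (u - v) = dot w u - dot w v.
Proof. by rewrite dotDr dotNr. Qed.

Lemma dot0l u : dot 0 u = 0.
Proof. by rewrite -(scale0r u) dotZl mul0r. Qed.

Lemma dot0r u : dot u 0 = 0.
Proof. by rewrite dotC dot0l. Qed.

Lemma dot_suml (I : Type) (r : seq I) (P : pred I) (F : I -> 'rV[R]_d) v :
  dot (\sum_(i <- r | P i) F i) v = \sum_(i <- r | P i) dot (F i) v.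
Proof. by apply: (big_morph (dot^~ v)) => [x y|]; rewrite ?dotDl ?dot0l. Qed.

Lemma dot_sumr (I : Type) (r : seq I) (P : pred I) (F : I -> 'rV[R]_d) v :
  dot v (\sum_(i <- r | P i) F i) = \sum_(i <- r | P i) dot v (F i).
Proof. by rewrite dotC dot_suml; apply: eq_bigr => i _; rewrite dotC. Qed.

Lemma dot_ge0 u : 0 <= dot u u.
Proof. by apply: sumr_ge0 => i _; rewrite -expr2 sqr_ge0. Qed.

Lemma dot_eq0 u : (dot u u == 0) = (u == 0).
Proof.
apply/eqP/eqP => [u0|->]; last by rewrite dot0l.
have sq i : 0 <= u ord0 i * u ord0 i by rewrite -expr2 sqr_ge0.
apply/rowP => i; rewrite mxE; apply/eqP; rewrite -sqrf_eq0 expr2.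
by move/eqP: u0; rewrite psumr_eq0 // => /allP/(_ i); rewrite mem_index_enum => /(_ isT).
Qed.

Lemma enorm_ge0 u : 0 <= enorm u.
Proof. exact: sqrtr_ge0. Qed.

Lemma enorm_sqr u : enorm u ^+ 2 = dot u u.
Proof. by rewrite sqr_sqrtr // dot_ge0. Qed.

Lemma enorm_eq0 u : (enorm u == 0) = (u == 0).
Proof. by rewrite -sqrf_eq0 enorm_sqr dot_eq0. Qed.

Lemma enormZ a u : enorm (a *: u) = `|a| * enorm u.
Proof. by rewrite /enorm dotZl dotZr mulrA -expr2 sqrtrM ?sqr_ge0 // sqrtr_sqr. Qed.

Lemma enormN u : enorm (- u) = enorm u.
Proof. by rewrite -scaleN1r enormZ normrN1 mul1r. Qed.

Lemma edistE u v : Defs.edist u v = enorm (u - v).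
Proof. by congr Num.sqrt; apply: eq_bigr => i _; rewrite !mxE expr2. Qed.

Lemma dot_le_enorm u v : dot u v <= enorm u * enorm v.
Proof.
have [/eqP|a0] := eqVneq (enorm u) 0.
  by rewrite enorm_eq0 => /eqP->; rewrite dot0l mulr_ge0 ?enorm_ge0.
have [/eqP|b0] := eqVneq (enorm v) 0.
  by rewrite enorm_eq0 => /eqP->; rewrite dot0r mulr_ge0 ?enorm_ge0.
have ab : 0 < enorm u * enorm v by rewrite mulr_gt0 // lt_neqAle eq_sym enorm_ge0 ?a0 ?b0.
have := dot_ge0 (enorm v *: u - enorm u *: v).
rewrite dotBl !dotBr !dotZl !dotZr (dotC v u) -!enorm_sqr => h.
rewrite -(ler_pM2l ab); move: h; set x := enorm u; set y := enorm v; set z := dot u v.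
by lra.
Qed.

End EuclideanSpace.

(** * The Hlawka inequality for |t|^(2p), p < 1/2 *)

Section Hlawka.
Context {R : realType}.
Implicit Types (x y z a b c e p r t : R).

(** This is |t|^(2p), written with a square to match the kernel of squared differences. *)
Definition sqpow p t := (t ^+ 2) `^ p.

Lemma sqpowN p t : sqpow p (- t) = sqpow p t.
Proof. by rewrite /sqpow sqrrN. Qed.

Lemma sqpowE p t : sqpow p t = `|t| `^ (2 * p).
Proof. by rewrite /sqpow powRrM -real_normK ?num_real // -powR_mulrn. Qed.

Lemma sqpow0 p : p != 0 -> sqpow p 0 = 0.
Proof. by move=> p0; rewrite /sqpow expr0n powR0. Qed.

Lemma ltr_sqpow p x y : 0 < p -> `|x| < `|y| -> sqpow p x < sqpow p y.
Proof.
by move=> p0 xy; rewrite !sqpowE; apply: gt0_ltr_powR xy; rewrite ?nnegrE ?mulr_gt0.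
Qed.

Lemma sum_bool3 (F : bool * bool * bool -> R) :
  \sum_k F k = \sum_i \sum_j \sum_k F (i, j, k).
Proof. by rewrite !pair_bigA; apply: eq_bigr => -[[]]. Qed.

(** The alternating sum runs over the subsets of {a, b, c}. For exponentials it factors into a
    product of three terms [1 - expR (- (s * t))], and only the empty subset has sum 0, with weight
    1. *)
Lemma powR_third_difference r a b c : 0 < r < 1 -> 0 < a -> 0 < b -> 0 < c ->
  (a + b) `^ r + (b + c) `^ r + (c + a) `^ r <
  a `^ r + b `^ r + c `^ r + (a + b + c) `^ r.
Proof.
move=> r01 a0 b0 c0; have /andP[r0 _] := r01.
pose kap (k : bool * bool * bool) : R := (-1) ^+ (k.1.1 + k.1.2 + k.2).
pose u (k : bool * bool * bool) : R := a *+ k.1.1 + b *+ k.1.2 + c *+ k.2.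
have : \sum_k kap k * u k `^ r < 0.
  apply: sum_powR_lt0 => //.
  - by move=> k; rewrite !addr_ge0 // mulrn_wge0 // ltW.
  - by rewrite sum_bool3 !big_bool /kap /=; ring.
  - move=> s s0; rewrite sum_bool3 !big_bool /kap /u /= !mulr1n !mulr0n ?addr0 ?add0r.
    rewrite !mulr0 oppr0 expR0 !mulrDr !opprD !expRD.
    have E t : 0 < t -> 0 <= 1 - expR (- (s * t)).
      by move=> t0; rewrite subr_ge0 -expR0 ler_expR oppr_le0 mulr_ge0 // ltW.
    have := mulr_ge0 (mulr_ge0 (E _ a0) (E _ b0)) (E _ c0).
    by set A := expR _; set B := expR _; set C := expR _; lra.
  - suff -> : \sum_(k | u k == 0) kap k = 1 by [].
    rewrite big_mkcond sum_bool3 !big_bool /kap /u /= ?mulr1n ?mulr0n ?addr0 ?add0r.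
    have [ab ac bc] : [/\ 0 < a + b, 0 < a + c & 0 < b + c] by split; rewrite addr_gt0.
    by rewrite eqxx !gt_eqF ?addr_gt0 // !add0r expr0.
rewrite sum_bool3 !big_bool /kap /u /= !mulr1n !mulr0n ?addr0 ?add0r.
by rewrite powR0 ?gt_eqF // [a + c]addrC; lra.
Qed.

(** For 0 < t < a + b the ratio t / (a + b) lies below its r-th power; this is added up for t = a
    and t = b. *)
Lemma powRD_lt r a b : 0 < r < 1 -> 0 < a -> 0 < b ->
  (a + b) `^ r < a `^ r + b `^ r.
Proof.
case/andP=> r0 r1 a0 b0; have ab : 0 < a + b by rewrite addr_gt0.
have H t : 0 < t -> t < a + b -> t / (a + b) * (a + b) `^ r < t `^ r.
  move=> t0 tab; have tq : 0 < t / (a + b) by rewrite divr_gt0.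
  rewrite -[in ltRHS](divfK (lt0r_neq0 ab) t) powRM ?(ltW tq) ?(ltW ab) //.
  rewrite ltr_pM2r ?powR_gt0 //; move: tq; set q := t / (a + b) => tq.
  have q1 : q < 1 by rewrite /q ltr_pdivrMr // mul1r.
  rewrite /powR gt_eqF // -{1}(@lnK _ q) ?posrE // ltr_expR.
  by rewrite -[ltLHS]mul1r ltr_nM2r // ln_lt0 // tq.
have := ltrD (H a a0 _) (H b b0 _); rewrite ltrDl ltrDr => /(_ b0 a0).
by rewrite -!mulrDl divff ?mul1r // gt_eqF.
Qed.

Section SmallExponent.
Variable p : R.
Hypothesis p_gt0 : 0 < p.
Hypothesis p_lt : p < 1 / 2.
Local Notation f := (sqpow p).

Let p2 : 0 < 2 * p < 1.
Proof. by move: p_gt0 p_lt => h1 h2; apply/andP; split; lra. Qed.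

Lemma sqpowE_gt0 t : 0 < t -> f t = t `^ (2 * p).
Proof. by move=> t0; rewrite sqpowE gtr0_norm. Qed.

Lemma hlawka_ppp a b c : 0 < a -> 0 < b -> 0 < c ->
  f (a + b) + f (b + c) + f (c + a) < f a + f b + f c + f (a + b + c).
Proof.
by move=> a0 b0 c0; rewrite !sqpowE_gt0 ?addr_gt0 //; exact: powR_third_difference.
Qed.

(** Since a - c = e - b and a - e = c - b, the two differences are dominated by the two members of
    one of the pairs {a, b} and {c, e}, depending on the order of a, c, e. Subadditivity on the
    other pair bounds [f (a + b)]. *)
Lemma hlawka_22 a b c e : 0 < a -> 0 < b -> 0 < c -> 0 < e -> a + b = c + e ->
  f (a + b) + f (a - c) + f (a - e) < f a + f b + f c + f e.
Proof.
move=> a0 b0 c0 e0 abce.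
have sub x y : 0 < x -> 0 < y -> f (x + y) <= f x + f y.
  by move=> x0 y0; rewrite !sqpowE_gt0 ?addr_gt0 //; exact/ltW/powRD_lt.
have lt x y : - y < x -> x < y -> f x < f y.
  by move=> xy1 xy2; apply: ltr_sqpow; rewrite // (gtr0_norm (x := y)) ?ltr_norml ?xy1 //; lra.
have s1 := sub _ _ a0 b0; have s2 := sub _ _ c0 e0; rewrite -abce in s2.
have [ac|ca] := leP c a; have [ae|ea] := leP e a.
- have : f (a - c) < f e by apply: lt; lra.
  have : f (a - e) < f c by apply: lt; lra.
  lra.
- have : f (a - e) < f b by apply: lt; lra.
  have : f (a - c) < f a by apply: lt; lra.
  lra.
- have : f (a - e) < f a by apply: lt; lra.
  have : f (a - c) < f b by apply: lt; lra.
  lra.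
- have : f (a - e) < f e by apply: lt; lra.
  have : f (a - c) < f c by apply: lt; lra.
  lra.
Qed.

(** The inequality is symmetric in the four numbers x, y, z and - (x + y + z) of sum 0. The sign of
    the last one decides whether three of them are positive, or two are positive and two
    negative. *)
Lemma hlawka_ppn x y z : 0 < x -> 0 < y -> z < 0 -> x + y + z != 0 ->
  f (x + y) + f (y + z) + f (z + x) < f x + f y + f z + f (x + y + z).
Proof.
move=> x0 y0 z0; rewrite neq_lt => /orP[s0|s0].
  have := @hlawka_ppp x y (- (x + y + z)) x0 y0; rewrite oppr_gt0 => /(_ s0).
  rewrite (_ : y + _ = - (z + x)); last by ring.
  rewrite (_ : - (x + y + z) + x = - (y + z)); last by ring.
  rewrite (_ : x + y + - _ = - z); last by ring.
  by rewrite !sqpowN; lra.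
have : 0 < - z by rewrite oppr_gt0.
move=> nz; have := @hlawka_22 x y (- z) (x + y + z) x0 y0 nz s0.
rewrite (_ : x - (x + y + z) = - (y + z)); last by ring.
rewrite opprK !sqpowN (addrC z x) => /(_ _); lra.
Qed.

Lemma hlawka_strict x y z : x != 0 -> y != 0 -> z != 0 -> x + y + z != 0 ->
  f (x + y) + f (y + z) + f (z + x) < f x + f y + f z + f (x + y + z).
Proof.
have cyc (t u v : R) : t + u + v = u + v + t by ring.
have two (t u v : R) : 0 < t -> 0 < u -> v != 0 -> t + u + v != 0 ->
    f (t + u) + f (u + v) + f (v + t) < f t + f u + f v + f (t + u + v).
  move=> t0 u0; rewrite neq_lt => /orP[v0|v0] s0; first exact: hlawka_ppn.
  exact: hlawka_ppp.
have key (t u v : R) : t != 0 -> u != 0 -> v != 0 -> t + u + v != 0 ->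
    [|| (0 < t) && (0 < u), (0 < u) && (0 < v) | (0 < v) && (0 < t)] ->
    f (t + u) + f (u + v) + f (v + t) < f t + f u + f v + f (t + u + v).
  move=> t0 u0 v0 s0 /or3P[/andP[t1 u1]|/andP[u1 v1]|/andP[v1 t1]].
  - exact: two.
  - by have := two u v t u1 v1 t0; rewrite -cyc => /(_ s0); lra.
  - by have := two v t u v1 t1 u0; rewrite (cyc v t u) => /(_ s0); lra.
move=> x0 y0 z0 s0.
have [|le2] := boolP [|| (0 < x) && (0 < y), (0 < y) && (0 < z) | (0 < z) && (0 < x)].
  exact: key.
(* Otherwise at least two of the numbers are negative; [f] is even, so all signs can be changed. *)
have := key (- x) (- y) (- z); rewrite !oppr_eq0 -!opprD !oppr_eq0 !sqpowN.
apply=> //; rewrite !oppr_gt0.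
by move: le2; case: (ltgtP x 0) x0 => //; case: (ltgtP y 0) y0 => //; case: (ltgtP z 0) z0.
Qed.

Lemma hlawka x y z : f (x + y) + f (y + z) + f (z + x) <= f x + f y + f z + f (x + y + z).
Proof.
have f0 : f 0 = 0 by rewrite sqpow0 // gt_eqF.
have [->|x0] := eqVneq x 0; first by rewrite !add0r addr0 f0; lra.
have [->|y0] := eqVneq y 0; first by rewrite !add0r !addr0 f0 (addrC z); lra.
have [->|z0] := eqVneq z 0; first by rewrite !add0r !addr0 f0; lra.
have [s0|s0] := eqVneq (x + y + z) 0; last exact/ltW/hlawka_strict.
have [xy yz zx] : [/\ x + y = - z, y + z = - x & z + x = - y] by split; lra.
by rewrite s0 f0 xy yz zx !sqpowN; lra.
Qed.

Definition pair_sum n (m : nat -> R) : R :=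
  \sum_(0 <= j < n) \sum_(0 <= i < j) f (m i + m j).

Lemma pair_sum_merge n (m : nat -> R) (m' := fun i => if i == n then m n + m n.+1 else m i) :
  pair_sum n.+2 m = pair_sum n.+1 m' + f (m n + m n.+1) +
    \sum_(0 <= i < n) (f (m i + m n) + f (m i + m n.+1) - f (m i + m n + m n.+1)).
Proof.
have E : pair_sum n.+1 m' = pair_sum n m + \sum_(0 <= i < n) f (m i + m n + m n.+1).
  rewrite /pair_sum big_nat_recr //=; congr (_ + _).
    apply: eq_big_nat => j /andP[_ jn]; apply: eq_big_nat => i /andP[_ ij].
    by rewrite /m' !ltn_eqF // (ltn_trans ij).
  by apply: eq_big_nat => i /andP[_ ij]; rewrite /m' eqxx ltn_eqF // addrA.
rewrite E sumrB big_split /= {1}/pair_sum !big_nat_recr //= -/(pair_sum n m).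
by ring.
Qed.

(** Merging the last two numbers lowers the coefficient by one, and the loss is the sum of the
    Hlawka defects of the triples that contain both. *)
Lemma pair_sum_step n (m : nat -> R) (m' := fun i => if i == n then m n + m n.+1 else m i) :
  pair_sum n.+2 m - n%:R * \sum_(0 <= i < n.+2) f (m i) =
  pair_sum n.+1 m' - (n%:R - 1) * \sum_(0 <= i < n.+1) f (m' i) -
  \sum_(0 <= i < n) (f (m i) + f (m n) + f (m n.+1) + f (m i + m n + m n.+1) -
     (f (m i + m n) + f (m n + m n.+1) + f (m n.+1 + m i))).
Proof.
have E : \sum_(0 <= i < n.+1) f (m' i) = \sum_(0 <= i < n) f (m i) + f (m n + m n.+1).
  rewrite big_nat_recr //= {2}/m' eqxx; congr (_ + _).
  by apply: eq_big_nat => i /andP[_ ij]; rewrite /m' ltn_eqF.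
rewrite pair_sum_merge -/m' E !big_nat_recr //=.
rewrite [X in _ - X = _](_ : _ = n%:R * \sum_(0 <= i < n) f (m i) +
  \sum_(0 <= i < n) (f (m n) + f (m n.+1))); last first.
  by rewrite big_const_nat subn0 iter_addr_0 -mulr_natl; ring.
have -> : \sum_(0 <= i < n) (f (m i) + f (m n) + f (m n.+1) + f (m i + m n + m n.+1) -
     (f (m i + m n) + f (m n + m n.+1) + f (m n.+1 + m i))) =
   \sum_(0 <= i < n) f (m i) + \sum_(0 <= i < n) (f (m n) + f (m n.+1)) -
   \sum_(0 <= i < n) (f (m i + m n) + f (m i + m n.+1) - f (m i + m n + m n.+1)) -
   \sum_(0 <= i < n) f (m n + m n.+1).
  rewrite -big_split -!sumrB /=; apply: eq_bigr => i _.
  by rewrite (addrC (m n.+1)); ring.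
have -> : \sum_(0 <= i < n) f (m n + m n.+1) = n%:R * f (m n + m n.+1).
  by rewrite big_const_nat subn0 iter_addr_0 mulr_natl.
by ring.
Qed.

Lemma pair_sum_le n (m : nat -> R) :
  pair_sum n.+2 m <= n%:R * \sum_(0 <= i < n.+2) f (m i) + f (\sum_(0 <= i < n.+2) m i).
Proof.
elim: n m => [|n IH] m.
  by rewrite mul0r add0r /pair_sum !big_nat_recr //= !big_geq // !add0r.
rewrite -lerBlDl pair_sum_step; set m' := fun i => _.
have := IH m'; rewrite -lerBlDl -[n.+1%:R - 1]/(n.+1%:R - 1%:R) -natrB // subn1 /=.
have -> : \sum_(0 <= i < n.+2) m' i = \sum_(0 <= i < n.+3) m i.
  rewrite [in RHS]big_nat_recr //= [in RHS]big_nat_recr //= -addrA big_nat_recr //=.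
  rewrite {2}/m' eqxx; congr (_ + _).
  by apply: eq_big_nat => i /andP[_ ij]; rewrite /m' ltn_eqF.
move=> h; apply: le_trans h; rewrite gerBl sumr_ge0 // => i _.
by rewrite subr_ge0 hlawka.
Qed.

Lemma pair_sum_lt n (m : nat -> R) : (4 <= n)%N -> (forall i, (i < n)%N -> m i != 0) ->
  \sum_(0 <= i < n) m i = 0 ->
  pair_sum n m < (n%:R - 2) * \sum_(0 <= i < n) f (m i).
Proof.
case: n => [|[|[|n]]] // n1 mn m0.
have nE : n.+3%:R - 2 = n.+1%:R :> R by rewrite -natrB // !subSS subn0.
rewrite nE -subr_lt0 pair_sum_step; set m' := fun i => _.
have := pair_sum_le n m'; rewrite -lerBlDl.
have -> : \sum_(0 <= i < n.+2) m' i = \sum_(0 <= i < n.+3) m i.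
  rewrite [in RHS]big_nat_recr //= [in RHS]big_nat_recr //= -addrA big_nat_recr //=.
  rewrite {2}/m' eqxx; congr (_ + _).
  by apply: eq_big_nat => i /andP[_ ij]; rewrite /m' ltn_eqF.
rewrite m0 sqpow0 ?gt_eqF // -[n.+1%:R - 1]/(n.+1%:R - 1%:R) -natrB // subn1 /= => h.
set Z := (X in _ - X < 0); suff Z0 : 0 < Z.
  by apply: le_lt_trans (lerD h (lexx (- Z))) _; rewrite add0r oppr_lt0.
rewrite /Z.
(* The merged sequence may contain 0, so strictness comes from a triple of nonzero sum. If there
   were none, all other entries would be - s, where s is the sum of the last two; the total - n s
   being 0, s and hence [m 0] would vanish. *)
have [i [ilt si]] : exists i, (i < n.+1)%N /\ m i + m n.+1 + m n.+2 != 0.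
  apply/not_existsP => H; have E i : (i < n.+1)%N -> m i = - (m n.+1 + m n.+2).
    move=> ilt; apply/eqP; rewrite -addr_eq0 addrA.
    by have /not_andP[//|/negP] := H i; rewrite negbK.
  have : \sum_(0 <= i < n.+3) m i = - (n%:R * (m n.+1 + m n.+2)).
    rewrite !big_nat_recr //= (eq_big_nat _ _ (F2 := fun=> - (m n.+1 + m n.+2))).
      by rewrite big_const_nat subn0 iter_addr_0 -mulr_natl (E n) //; ring.
    by move=> i /andP[_ ilt]; apply: E; rewrite (ltn_trans ilt).
  rewrite m0 => /esym/eqP; rewrite oppr_eq0 mulf_eq0 pnatr_eq0 => /orP[/eqP nn|/eqP s0].
    by rewrite nn in n1.
  by have := mn 0%N isT; rewrite E // s0 oppr0 eqxx.
rewrite big_mkord (bigD1 (Ordinal ilt)) //= ltr_pwDl //.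
  by rewrite subr_gt0 hlawka_strict // mn //; lia.
by apply: sumr_ge0 => j _; rewrite subr_ge0 hlawka.
Qed.

End SmallExponent.
End Hlawka.

(** * Stable stars *)

Section PlanarStar.
Context {R : realType}.
Implicit Types (x y t p : R).

Definition polar t : 'rV[R]_2 := \row_(j < 2) (if j == ord0 then cos t else sin t).

Lemma dot_polar x y : dot (polar x) (polar y) = cos (x - y).
Proof. by rewrite /dot big_ord_recl big_ord1 !mxE /= cosB. Qed.

(* The test vector is the linear dependency of three coplanar unit vectors
   enclosing the angles [x] and [y]. *)
Lemma spherical_triangle x y (u v g : R) : 0 < x -> 0 < y -> x + y <= pi ->
    cos x <= u -> cos y <= v ->
    (forall a b c : R, 0 <= a ^+ 2 + b ^+ 2 + c ^+ 2 +
       2 * (a * b * u + b * c * v + a * c * g)) ->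
  cos (x + y) <= g.
Proof.
move=> x0 y0 xy xu yv /(_ (sin y) (- sin (x + y)) (sin x)).
have sx : 0 < sin x by apply: sin_gt0_pi; apply/andP; split; lra.
have sy : 0 < sin y by apply: sin_gt0_pi; apply/andP; split; lra.
have sxy : 0 <= sin (x + y) by apply: sin_ge0_pi; apply/andP; split; lra.
move=> H.
have h1 : sin y * sin (x + y) * cos x <= sin y * sin (x + y) * u.
  by rewrite ler_wpM2l // mulr_ge0 // ltW.
have h2 : sin x * sin (x + y) * cos y <= sin x * sin (x + y) * v.
  by rewrite ler_wpM2l // mulr_ge0 // ltW.
rewrite -subr_ge0 -(pmulr_rge0 _ (mulr_gt0 sx sy)).
have cx := cos2Dsin2 x; have cy := cos2Dsin2 y.
(* For coplanar unit vectors the quadratic form vanishes at the test vector. *)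
have E : sin y ^+ 2 + sin (x + y) ^+ 2 + sin x ^+ 2 - 2 * (sin y * sin (x + y) * cos x)
    - 2 * (sin x * sin (x + y) * cos y) + 2 * (sin x * sin y * cos (x + y)) = 0.
  rewrite sinD cosD.
  transitivity (sin x ^+ 2 * (1 - (cos y ^+ 2 + sin y ^+ 2)) +
    sin y ^+ 2 * (1 - (cos x ^+ 2 + sin x ^+ 2))); first by ring.
  by rewrite cx cy subrr !mulr0 addr0.
rewrite mulrBr; lra.
Qed.

(** * A planar star unrolled periodically *)

Section Periodic.
(** The edges are listed by increasing angle [T] and continued with period [n], each turn adding 2
    pi to the angle. Cyclically consecutive edges thus form an interval of indices. *)
Variables (p : R) (n : nat) (W : nat -> 'rV[R]_2) (r T m : nat -> R).
Hypothesis p01 : 0 < p < 1.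
Hypothesis n_ge4 : (4 <= n)%N.
Hypothesis WE : forall k, W k = r k *: polar (T k).
Hypothesis r_gt0 : forall k, 0 < r k.
Hypothesis T_lt : forall k, T k < T k.+1.
Hypothesis T_per : forall k, T (k + n)%N = T k + pi *+ 2.
Hypothesis W_per : forall k, W (k + n)%N = W k.
Hypothesis m_per : forall k, m (k + n)%N = m k.
Hypothesis m_sum : \sum_(0 <= k < n) m k = 0.
Hypothesis W_norm : forall k, dot (W k) (W k) = sqpow p (m k).
Hypothesis window : forall a b, (a <= b <= a + n)%N ->
  dot (\sum_(a <= k < b) W k) (\sum_(a <= k < b) W k) <= sqpow p (\sum_(a <= k < b) m k).

Let p0 : 0 < p. Proof. by case/andP: p01. Qed.
(** [D k l] is the squared distance of the embedded points [M k] and [M l]. By polarization, [B k l]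
    is the inner product of the sides that start at [M k] and [M l]. *)
Let M k := \sum_(0 <= i < k) m i.
Let D k l := sqpow p (M k - M l).
Let B k l := (D k.+1 l + D k l.+1 - D k l - D k.+1 l.+1) / 2.

Lemma window_diff a b : (a <= b)%N -> \sum_(a <= k < b) m k = M b - M a.
Proof. by move=> ab; rewrite /M [in RHS](big_cat_nat (n := a)) //= [RHS]addrC addKr. Qed.

Lemma M_per k : M (k + n)%N = M k.
Proof.
elim: k => [|k IH]; first by rewrite add0n /M m_sum big_geq.
by rewrite addSn /M !big_nat_recr //= -!/(M _) IH m_per.
Qed.

Lemma DC k l : D k l = D l k.
Proof. by rewrite /D -sqpowN opprB. Qed.

Lemma BC k l : B k l = B l k.
Proof. by rewrite /B !(DC k) !(DC k.+1); lra. Qed.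

Lemma D_diag k : D k k = 0.
Proof. by rewrite /D subrr sqpow0 // gt_eqF. Qed.

Lemma D_step k : D k.+1 k = sqpow p (m k).
Proof. by rewrite /D /M big_nat_recr //= addrAC subrr add0r. Qed.

Lemma r_sqr k : r k ^+ 2 = sqpow p (m k).
Proof. by rewrite -W_norm WE dotZl dotZr dot_polar subrr cos0 mulr1 expr2. Qed.

Lemma B_diag k : B k k = r k ^+ 2.
Proof. by rewrite /B (DC k) !D_diag D_step r_sqr; lra. Qed.

(** [B] is a Gram matrix: the side of index [k i] with coefficient [c i] puts weight [c i] at its
    end and [- c i] at its start, and these weights add up to 0. *)
Lemma B_psd (I : finType) (c : I -> R) (k : I -> nat) :
  0 <= \sum_i \sum_j c i * c j * B (k i) (k j).
Proof.
pose l (a : I * bool) := if a.2 then c a.1 else - c a.1.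
pose x (a : I * bool) := M (k a.1 + a.2)%N.
have l0 : \sum_a l a = 0.
  rewrite -(pair_bigA _ (fun i b => l (i, b))) /= big1 // => i _.
  by rewrite big_bool /l /= subrr.
have := sqdist_powR_le0 x p01 l0.
rewrite -(pair_bigA _ (fun i b => \sum_a l (i, b) * l a * ((x (i, b) - x a) ^+ 2) `^ p)) /=.
have -> : \sum_i \sum_b \sum_a l (i, b) * l a * ((x (i, b) - x a) ^+ 2) `^ p =
    - (2 * \sum_i \sum_j c i * c j * B (k i) (k j)).
  rewrite mulr_sumr -sumrN; apply: eq_bigr => i _.
  rewrite exchange_big /= -(pair_bigA _ (fun j s => \sum_b l (i, b) * l (j, s) * ((x (i, b) - x (j, s)) ^+ 2) `^ p)) /=.
  rewrite mulr_sumr -sumrN; apply: eq_bigr => j _.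
  rewrite !big_bool /l /x /= !addn1 !addn0 -!/(sqpow p _) -!/(D _ _) /B; lra.
by rewrite oppr_le0 pmulr_rge0.
Qed.

Lemma B_step k : r k * r k.+1 * cos (T k.+1 - T k) <= B k k.+1.
Proof.
have : D k.+2 k >= dot (W k + W k.+1) (W k + W k.+1).
  have := @window k k.+2; rewrite leqW //= -addn2 leq_add2l (leq_trans _ n_ge4) // addn2.
  by move=> /(_ isT); rewrite window_diff ?leqW // !big_nat_recr //= ?leqW // big_geq // add0r.
rewrite dotDl !dotDr !W_norm (dotC (W k.+1)) /B D_diag (DC k) (DC k.+1) (DC k) !D_step.
rewrite !WE dotZl dotZr dot_polar -(cosN (T k - _)) opprB; lra.
Qed.

(** Induction on [j]: the angle between the sides [i] and [j] is at most the sum of the angles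
    between consecutive sides, each bounded by the plane angle through [B_step]. *)
Lemma B_chain i j : (i < j)%N -> T j - T i <= pi -> r i * r j * cos (T j - T i) <= B i j.
Proof.
elim: j => // j IH; rewrite ltnS leq_eqVlt => /predU1P[<-|ij] Tij; first exact: B_step.
have Tlt : T i < T j by exact: (homo_ltn lt_trans T_lt).
have Tj := T_lt j.
have Tji : T j - T i <= pi by lra.
have {IH}h1 := IH ij Tji.
have h2 := B_step j.
have [ri rj rj1] : [/\ 0 < r i, 0 < r j & 0 < r j.+1] by [].
have := @spherical_triangle (T j - T i) (T j.+1 - T j) (B i j / (r i * r j))
  (B j j.+1 / (r j * r j.+1)) (B i j.+1 / (r i * r j.+1)).
rewrite (_ : T j - T i + (T j.+1 - T j) = T j.+1 - T i); last by ring.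
rewrite (ler_pdivlMr _ _ (mulr_gt0 ri rj)) (ler_pdivlMr _ _ (mulr_gt0 rj rj1)).
rewrite (ler_pdivlMr _ _ (mulr_gt0 ri rj1)) ![_ * (r _ * r _)]mulrC.
apply=> //; [lra|lra|move=> a b c].
pose cc (s : 'I_3) := [:: a / r i; b / r j; c / r j.+1]`_s.
pose kk (s : 'I_3) := nth 0%N [:: i; j; j.+1] s.
have := B_psd cc kk; rewrite !big_ord_recl !big_ord0 /cc /kk /= !B_diag.
rewrite (BC j i) (BC j.+1 i) (BC j.+1 j).
congr (0 <= _); field.
by rewrite !gt_eqF.
Qed.

(** The embedded polygon closes up after [n] sides, so the inner sums telescope. *)
Lemma B_sum0 : \sum_(0 <= k < n) \sum_(0 <= l < n) B k l = 0.
Proof.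
apply: big1 => k _.
have E l : B k l = ((D k l.+1 - D k.+1 l.+1) - (D k l - D k.+1 l)) / 2 by rewrite /B; lra.
under eq_bigr do rewrite E.
rewrite -mulr_suml telescope_sumr // /D.
by rewrite (_ : M n = M 0) ?subrr ?mul0r // -[n in LHS]add0n M_per.
Qed.

Lemma T_mono i j : (i < j)%N -> T i < T j.
Proof. by move=> ij; apply: (homo_ltn lt_trans T_lt). Qed.

Lemma W_sum : \sum_(0 <= k < n) W k = 0.
Proof.
apply/eqP; rewrite -dot_eq0 eq_le dot_ge0 andbT.
by have := @window 0%N n; rewrite m_sum sqpow0 ?gt_eqF // add0n leqnn => /(_ isT).
Qed.

(** If the angle from [i] to [j] exceeds pi, the chain is followed the other way around, from [j] to
    [i + n]. *)
Lemma B_ge i j : (i < n)%N -> (j < n)%N -> dot (W i) (W j) <= B i j.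
Proof.
wlog ij : i j / (i <= j)%N.
  move=> H ilt jlt; have [ij|/ltnW ji] := leqP i j; first exact: H.
  by rewrite dotC BC; apply: H.
move=> ilt jlt; rewrite !WE dotZl dotZr dot_polar mulrA.
move: ij; rewrite leq_eqVlt => /predU1P[->|ij].
  by rewrite subrr cos0 mulr1 B_diag expr2.
have [Tij|Tij] := leP (T j - T i) pi.
  by rewrite -(cosN (T i - _)) opprB B_chain.
have := @B_chain j (i + n)%N; rewrite T_per.
rewrite (leq_trans jlt) ?leq_addl // => /(_ isT).
have -> : B j (i + n) = B i j by rewrite BC /B /D -addSn !M_per.
have -> : r (i + n)%N = r i.
  apply/eqP; rewrite -(@eqrXn2 _ 2) // ?(ltW (r_gt0 _)) //.
  by rewrite !r_sqr m_per.
rewrite (_ : T i + pi *+ 2 - T j = (T i - T j) + pi *+ 2); last by ring.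
rewrite cosD2pi (mulrC (r j)) mulr2n; apply.
by lra.
Qed.

(** The differences of the two sides are nonnegative and add up to 0, because both polygons are
    closed. *)
Lemma B_eq i j : (i < n)%N -> (j < n)%N -> B i j = dot (W i) (W j).
Proof.
move=> ilt jlt; apply/eqP; rewrite -subr_eq0.
have ge0 (k l : 'I_n) : 0 <= B k l - dot (W k) (W l) by rewrite subr_ge0 B_ge.
have : \sum_(k < n) \sum_(l < n) (B k l - dot (W k) (W l)) = 0.
  under eq_bigr do rewrite sumrB -dot_sumr.
  rewrite sumrB -dot_suml -(big_mkord xpredT W) W_sum dot0l subr0.
  by rewrite -[RHS]B_sum0 big_mkord; apply: eq_bigr => k _; rewrite big_mkord.
move/eqP; rewrite psumr_eq0; last by move=> k _; apply: sumr_ge0.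
move/allP/(_ (Ordinal ilt)); rewrite mem_index_enum => /(_ isT) /=.
rewrite psumr_eq0; last by move=> l _; exact: (ge0 (Ordinal ilt)).
move/allP/(_ (Ordinal jlt)); rewrite mem_index_enum => /(_ isT) /=.
by [].
Qed.

(** All these vectors make an angle less than pi / 2 with the bisector [c] of the first and the last
    one. *)
Lemma short_window_neq0 a b : (a < b)%N -> T b.-1 - T a < pi ->
  \sum_(a <= k < b) W k != 0.
Proof.
case: b => // b; rewrite ltnS /= => ab Tab; apply/eqP => W0.
pose c := polar ((T a + T b) / 2).
have : 0 < dot (\sum_(a <= k < b.+1) W k) c.
  have pos k : (a <= k < b.+1)%N -> 0 < dot (W k) c.
    case/andP=> ak kb; rewrite WE dotZl dot_polar mulr_gt0 //.
    have [h1 h2] : T a <= T k /\ T k <= T b.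
      have mono i j : (i <= j)%N -> T i <= T j.
        by rewrite leq_eqVlt => /predU1P[->//|/T_mono/ltW].
      by split; apply: mono.
    by apply: cos_gt0_pihalf; apply/andP; split; lra.
  rewrite dot_suml big_ltn ?ltnS // ltr_pwDl ?pos ?leqnn //=.
  rewrite big_nat_cond sumr_ge0 // => k; rewrite andbT => /andP[ak kb].
  by rewrite ltW // pos // (ltnW ak).
by rewrite W0 dot0l ltxx.
Qed.

Lemma W_sum_period i : \sum_(i <= k < i + n) W k = 0.
Proof.
elim: i => [|i IH]; first by rewrite add0n W_sum.
rewrite addSn big_nat_recr /=; last by rewrite -addn1 leq_add2l (leq_trans _ n_ge4).
by rewrite W_per addrC -big_ltn // -[ltnLHS]addn0 ltn_add2l (leq_trans _ n_ge4).
Qed.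

(** If the two partial sums agreed, stability would make the vectors from [i] to [j] add up to 0,
    and so would those from [j] to [i + n]. One of these two windows spans an angle less than pi. *)
Lemma M_inj i j : (i < j)%N -> (j <= 3)%N -> M i != M j.
Proof.
move=> ij j3; rewrite eq_sym -subr_eq0; apply/eqP => M0.
have jn : (j < n)%N by rewrite (leq_ltn_trans j3).
have W0 : \sum_(i <= k < j) W k = 0.
  apply/eqP; rewrite -dot_eq0 eq_le dot_ge0 andbT.
  have := @window i j; rewrite window_diff ?(ltnW ij) // M0 sqpow0 ?gt_eqF //; apply.
  by rewrite /= (leq_trans (ltnW jn)) ?leq_addl.
have [short|long] := ltP (T j.-1 - T i) pi.
  by move: (short_window_neq0 ij short); rewrite W0 eqxx.
have ji : (j < i + n)%N by rewrite (leq_trans jn) ?leq_addl.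
have := short_window_neq0 ji.
have -> : \sum_(j <= k < i + n) W k = 0.
  have := W_sum_period i; rewrite (big_cat_nat (n := j)) /= ?(ltnW ij) ?(ltnW ji) //.
  by rewrite W0 add0r.
rewrite eqxx; have : T (i + n).-1 < T (i + n)%N.
  by apply: T_mono; rewrite prednK // (leq_ltn_trans _ ji).
have : T j.-1 < T j by apply: T_mono; rewrite prednK // (leq_ltn_trans _ ij).
rewrite T_per mulr2n => h1 h2 h3; suff : ~~ true by [].
by apply: h3; lra.
Qed.

(** Three vectors of the plane are linearly dependent. By [B_eq] the first three sides satisfy the
    same relation, although the four distinct vertices [M 0], ..., [M 3] are affinely independent
    after embedding. *)
Lemma periodic_star_absurd : False.
Proof.
pose A := \matrix_(k < 3, j < 2) W k ord0 j.
have : \rank (kermx A) != 0%N.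
  by rewrite mxrank_ker subn_eq0 -ltnNge ltnS (leq_trans (rank_leq_col A)).
rewrite mxrank_eq0 => /rowV0Pn[c /sub_kermxP cA c0].
have Wdep : \sum_(k < 3) c ord0 k *: W k = 0.
  apply/rowP => j; rewrite summxE mxE.
  move/rowP: cA => /(_ j); rewrite !mxE => E; rewrite -[RHS]E; apply: eq_bigr => k _.
  by rewrite !mxE.
have quad : \sum_(k < 3) \sum_(l < 3) c ord0 k * c ord0 l * B k l = 0.
  have lt3 (k : 'I_3) : (k < n)%N by rewrite (leq_trans (ltn_ord k)) // (leq_trans _ n_ge4).
  transitivity (dot (\sum_(k < 3) c ord0 k *: W k) (\sum_(l < 3) c ord0 l *: W l)).
    rewrite dot_suml; apply: eq_bigr => k _; rewrite dot_sumr; apply: eq_bigr => l _.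
    by rewrite B_eq // dotZl dotZr mulrA.
  by rewrite Wdep dot0l.
pose x0 := c ord0 ord0; pose x1 := c ord0 (lift ord0 ord0).
pose x2 := c ord0 (lift ord0 (lift ord0 ord0)).
(* Summation by parts turns the coefficients of the three sides into weights of their four
   vertices. *)
pose l (k : 'I_4) := [:: - x0; x0 - x1; x1 - x2; x2]`_k.
have l0 : \sum_k l k = 0 by rewrite !big_ord_recl big_ord0 /l /=; ring.
have xI : injective (fun k : 'I_4 => M k).
  move=> i j /= Mij; apply: val_inj; case: (ltngtP i j) => // ij.
    by have := M_inj ij (ltn_ord j); rewrite Mij eqxx.
  by have := M_inj ij (ltn_ord i); rewrite Mij eqxx.
have lN0 : exists k, l k != 0.
  apply/existsP; apply: contraNT c0; rewrite negb_exists => /forallP H.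
  have := H ord0; have := H (lift ord0 ord0); have := H (lift ord0 (lift ord0 ord0)).
  have := H ord_max; rewrite !negbK /l /= => /eqP h2 /eqP h1 /eqP h0 _.
  apply/eqP/rowP => k; rewrite mxE.
  have /or3P : [|| k == ord0, k == lift ord0 ord0 | k == lift ord0 (lift ord0 ord0)].
    by case: k => -[|[|[|]]].
  by case=> /eqP->; rewrite -/x0 -/x1 -/x2; lra.
have := sqdist_powR_lt0 p01 xI l0 lN0.
move: quad; rewrite !big_ord_recl !big_ord0 /l /= -/x0 -/x1 -/x2 /bump /=.
rewrite ?add1n ?add0n -!/(sqpow p _) -!/(D _ _) /B.
rewrite !D_diag (DC 1 0) (DC 2 0) (DC 2 1) (DC 3 0) (DC 3 1) (DC 3 2).
lra.
Qed.

End Periodic.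
End PlanarStar.

(** * Degree bounds for stable stars *)

Section StableStar.
Context {R : realType}.
Implicit Types (x y t : R).

(* [W e] is the pull exerted by the edge [e] on the branching point and [M e] its
   signed flow; the last condition says that no group of edges can profitably be
   split off the branching point. *)
Definition stable_star (p : R) d (E : eqType) (s : seq E) (W : E -> 'rV[R]_d) (M : E -> R) :=
  [/\ uniq s, forall e, e \in s -> M e != 0 /\ dot (W e) (W e) = sqpow p (M e),
      \sum_(e <- s) M e = 0 &
      forall P : pred E, dot (\sum_(e <- s | P e) W e) (\sum_(e <- s | P e) W e) <=
        sqpow p (\sum_(e <- s | P e) M e)].

Lemma big_subseq_mem (V : nmodType) (E : eqType) (s t : seq E) (F : E -> V) :
  uniq s -> uniq t -> {subset t <= s} -> \sum_(e <- s | e \in t) F e = \sum_(e <- t) F e.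
Proof.
move=> us ut ts; rewrite -big_filter; apply: perm_big; apply: uniq_perm => //.
  exact: filter_uniq.
by move=> e; rewrite mem_filter; case et: (e \in t); rewrite //= ts.
Qed.

Lemma stable_subseq p d (E : eqType) (s t : seq E) (W : E -> 'rV[R]_d) M :
  stable_star p s W M -> uniq t -> {subset t <= s} ->
  dot (\sum_(e <- t) W e) (\sum_(e <- t) W e) <= sqpow p (\sum_(e <- t) M e).
Proof.
by case=> us _ _ H ut ts; rewrite -!(big_subseq_mem _ us ut ts).
Qed.

Lemma stable_total p d (E : eqType) (s : seq E) (W : E -> 'rV[R]_d) M :
  0 < p -> stable_star p s W M -> \sum_(e <- s) W e = 0.
Proof.
move=> p0 st; have [us _ M0 _] := st; apply/eqP; rewrite -dot_eq0 eq_le dot_ge0 andbT.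
by have := stable_subseq st us (fun _ => id); rewrite M0 sqpow0 // gt_eqF.
Qed.

Lemma sum_dot_pairs d n (w : nat -> 'rV[R]_d) :
  \sum_(0 <= j < n) \sum_(0 <= i < j) dot (w i + w j) (w i + w j) =
  (n%:R - 2) * \sum_(0 <= i < n) dot (w i) (w i) +
  dot (\sum_(0 <= i < n) w i) (\sum_(0 <= i < n) w i).
Proof.
elim: n => [|n IH]; first by rewrite !big_geq // dot0l mulr0 addr0.
rewrite !big_nat_recr //= IH dotDl !dotDr (dotC (w n) (\sum_(0 <= i < n) w i)).
have -> : \sum_(0 <= i < n) dot (w i + w n) (w i + w n) =
    \sum_(0 <= i < n) dot (w i) (w i) + 2 * dot (\sum_(0 <= i < n) w i) (w n) +
    n%:R * dot (w n) (w n).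
  have -> : n%:R * dot (w n) (w n) = \sum_(0 <= i < n) dot (w n) (w n).
    by rewrite big_const_nat subn0 iter_addr_0 mulr_natl.
  rewrite dot_suml mulr_sumr -!big_split; apply: eq_bigr => i _ /=.
  by rewrite dotDl !dotDr (dotC (w n)); ring.
by rewrite -natr1; ring.
Qed.

(** As the vectors add up to 0, the squared norms of their pair sums total (n - 2) times the sum of
    the squared norms. Stability of each pair then contradicts [pair_sum_lt]. *)
Lemma small_exponent_star p d (E : eqType) (s : seq E) (W : E -> 'rV[R]_d) M :
  0 < p -> p < 1 / 2 -> stable_star p s W M -> (size s <= 3)%N.
Proof.
move=> p0 p2 st; have [us WM M0 _] := st; rewrite leqNgt; apply/negP => n4.
have [e0 _] : exists e, e \in s by case: (s) n4 => // e ? _; exists e; rewrite mem_head.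
pose m k := M (nth e0 s k); pose w k := W (nth e0 s k).
have ns k : (k < size s)%N -> nth e0 s k \in s by exact: mem_nth.
have sm (V : nmodType) (F : E -> V) : \sum_(0 <= k < size s) F (nth e0 s k) = \sum_(e <- s) F e.
  by rewrite (big_nth e0).
have m0 : \sum_(0 <= k < size s) m k = 0 by rewrite sm.
have := pair_sum_lt p0 p2 n4 _ m0.
move=> /(_ (fun k klt => (WM _ (ns k klt)).1)); apply/negP; rewrite -leNgt.
have -> : \sum_(0 <= k < size s) sqpow p (m k) = \sum_(0 <= k < size s) dot (w k) (w k).
  by apply: eq_big_nat => k /andP[_ klt]; rewrite (WM _ (ns k klt)).2.
have := sum_dot_pairs (size s) w; rewrite (sm _ W) (stable_total p0 st) dot0l addr0 => <-.
rewrite /pair_sum big_nat_cond [leRHS]big_nat_cond.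
apply: ler_sum => j; rewrite andbT => /andP[_ jlt].
rewrite big_nat_cond [leRHS]big_nat_cond.
apply: ler_sum => i; rewrite andbT => /andP[_ ij].
have ilt := ltn_trans ij jlt.
have := @stable_subseq _ _ _ _ [:: nth e0 s i; nth e0 s j] _ _ st.
rewrite !big_cons !big_nil !addr0 /= andbT inE nth_uniq // ltn_eqF //; apply=> //.
by move=> e; rewrite !inE => /orP[]/eqP->; apply: ns.
Qed.

Definition arg (v : 'rV[R]_2) : R :=
  if 0 <= v ord0 ord_max then acos (v ord0 ord0 / enorm v)
  else - acos (v ord0 ord0 / enorm v).

Lemma argP (v : 'rV[R]_2) : v != 0 -> v = enorm v *: polar (arg v) /\ - pi < arg v <= pi.
Proof.
move=> v0; set a := v ord0 ord0; set b := v ord0 ord_max; set e := enorm v.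
have e0 : 0 < e by rewrite lt_neqAle eq_sym enorm_eq0 v0 enorm_ge0.
have e2 : e ^+ 2 = a ^+ 2 + b ^+ 2.
  rewrite enorm_sqr /dot big_ord_recl big_ord1 -!expr2.
  by congr (_ + v ord0 _ ^+ 2); apply: val_inj.
have ab1 : (b / e) ^+ 2 = 1 - (a / e) ^+ 2.
  by rewrite !expr_div_n e2; field; rewrite -e2 expf_neq0 ?gt_eqF.
have ae : -1 <= a / e <= 1.
  by rewrite -ler_norml -[leRHS](normr1 R) -ler_sqr ?nnegrE // !real_normK ?num_real // expr1n -subr_ge0 -ab1 sqr_ge0.
have cosE : cos (acos (a / e)) = a / e by rewrite acosK // in_itv.
have sinE : sin (acos (a / e)) = `|b / e| by rewrite sin_acos // -ab1 sqrtr_sqr.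
have [h0 h1] : 0 <= acos (a / e) /\ acos (a / e) <= pi by rewrite acos_ge0 // acos_lepi.
have pi0 := pi_gt0 R.
have eq2 (u w : 'rV[R]_2) : u ord0 ord0 = w ord0 ord0 -> u ord0 ord_max = w ord0 ord_max -> u = w.
  move=> h h'; apply/rowP => j; have [->//|->//] : j = ord0 \/ j = ord_max.
  by case: j => -[|[|//]] i; [left|right]; apply: val_inj.
rewrite /arg -/a -/b -/e; case: (leP 0 b) => b0.
  split; last by apply/andP; split; lra.
  apply: eq2; rewrite !mxE /= -?/a -?/b ?cosE ?sinE.
    by rewrite mulrC divfK ?gt_eqF.
  by rewrite ger0_norm ?divr_ge0 ?(ltW e0) // mulrC divfK ?gt_eqF.
split.
  apply: eq2; rewrite !mxE /= -?/a -?/b ?cosN ?sinN ?cosE ?sinE.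
    by rewrite mulrC divfK ?gt_eqF.
  rewrite ler0_norm; first by rewrite opprK mulrC divfK ?gt_eqF.
  by apply: mulr_le0_ge0; rewrite ?invr_ge0 ltW.
(* The angle - pi is excluded: it would force the second coordinate to vanish, but that is negative
   here. *)
apply/andP; split; last by lra.
rewrite ltrN2 lt_neqAle h1 andbT; apply/eqP => H.
move: sinE; rewrite H sinpi => /esym/eqP; rewrite normr_eq0 mulf_eq0 invr_eq0 (gt_eqF e0) orbF.
by rewrite lt_eqF.
Qed.

(** The norms of two vectors of equal direction add up, and |m|^p + |m'|^p exceeds |m + m'|^p,
    against stability of the pair. *)
Lemma stable_arg_inj p (E : eqType) (s : seq E) (W : E -> 'rV[R]_2) M a b :
  0 < p < 1 -> stable_star p s W M -> a \in s -> b \in s -> a != b ->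
  arg (W a) != arg (W b).
Proof.
move=> p01 st ain bin ab; have [us WM _ _] := st; have /andP[p0 _] := p01.
have nm e : e \in s -> [/\ W e != 0, 0 < `|M e| & enorm (W e) = `|M e| `^ p].
  move=> ein; have [M0 WE] := WM e ein.
  rewrite -dot_eq0 WE normr_gt0 M0 sqpowE powR_eq0 normr_eq0 (negPf M0); split=> //.
  by rewrite /enorm WE sqpowE mulrC powRrM powR_mulrn ?powR_ge0 // sqrtr_sqr ger0_norm ?powR_ge0.
have [Wa Ma ea] := nm a ain; have [Wb Mb eb] := nm b bin.
apply/eqP => H; have := @stable_subseq _ _ _ _ [:: a; b] _ _ st.
rewrite !big_cons !big_nil !addr0 /= andbT inE ab => /(_ isT).
have /[swap]/[apply] : {subset [:: a; b] <= s} by move=> e; rewrite !inE => /orP[]/eqP->.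
apply/negP; rewrite -ltNge.
have [-> _] := argP Wa; have [-> _] := argP Wb; rewrite H -scalerDl.
rewrite dotZl dotZr dot_polar subrr cos0 mulr1 ea eb -expr2.
rewrite sqpowE mulrC powRrM powR_mulrn ?powR_ge0 // ltr_sqr ?nnegrE ?addr_ge0 ?powR_ge0 //.
apply: le_lt_trans (powRD_lt p01 Ma Mb).
by apply: ge0_ler_powR; rewrite ?nnegrE ?addr_ge0 ?(ltW p0) ?ler_normD.
Qed.

Lemma planar_star p (E : eqType) (s : seq E) (W : E -> 'rV[R]_2) M :
  0 < p < 1 -> stable_star p s W M -> (size s <= 3)%N.
Proof.
move=> p01 st; have [us WM M0 _] := st; rewrite leqNgt; apply/negP => n4.
have /andP[p0 _] := p01.
have [e0 _] : exists e, e \in s by case: (s) n4 => // e ? _; exists e; rewrite mem_head.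
pose th e := arg (W e); pose leT := [rel a b | th a <= th b].
pose s' := sort leT s.
have ms e : (e \in s') = (e \in s) by rewrite mem_sort.
have us' : uniq s' by rewrite sort_uniq.
have Wne e : e \in s -> W e != 0.
  by move=> /WM[Mn WE]; rewrite -dot_eq0 WE sqpowE powR_eq0 normr_eq0 (negPf Mn).
pose n := size s'; have nE : n = size s by rewrite /n size_sort.
have n0 : (0 < n)%N by rewrite nE (leq_trans _ n4).
(* Indices are read modulo [n]; the quotient [k %/ n] counts the turns and supplies the multiple of
   2 pi in the angle. *)
pose e k := nth e0 s' (k %% n).
have es k : e k \in s by rewrite -ms mem_nth // ltn_mod.
have tot : total leT by move=> a b; exact: le_total.
have tr : transitive leT by move=> b a c; exact: le_trans.
have th_lt i j : (i < j)%N -> (j < n)%N -> th (nth e0 s' i) < th (nth e0 s' j).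
  move=> ij jn; have ilt := ltn_trans ij jn.
  rewrite lt_neqAle (stable_arg_inj p01 st) -?ms ?mem_nth //=; last first.
    by rewrite nth_uniq // ltn_eqF.
  by apply: (sorted_ltn_nth tr e0 (sort_sorted tot s)) ij; rewrite inE.
have per k : ((k + n) %% n = k %% n)%N by rewrite modnDr.
apply: (@periodic_star_absurd R p n (fun k => W (e k)) (fun k => enorm (W (e k)))
  (fun k => th (e k) + pi *+ 2 *+ (k %/ n)) (fun k => M (e k))) => //.
- by rewrite nE.
- move=> k; have [h _] := argP (Wne _ (es k)); rewrite {1}h; congr (_ *: _).
  by apply/rowP => j; rewrite !mxE (periodicn (@cosD2pi R)) (periodicn (@sinD2pi R)).
- by move=> k; rewrite lt_neqAle eq_sym enorm_eq0 Wne // enorm_ge0.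
- move=> k; rewrite /e.
  have kE : k.+1 = (k %/ n * n + (k %% n).+1)%N by rewrite addnS -divn_eq.
  have [kn|kn] := ltnP (k %% n).+1 n.
    have [-> ->] : (k.+1 %% n = (k %% n).+1 /\ k.+1 %/ n = k %/ n)%N.
      by rewrite kE modnMDl divnMDl // (modn_small kn) (divn_small kn) addn0.
    by rewrite ltrD2r th_lt.
  have kn' : (k %% n).+1 = n by apply/eqP; rewrite eqn_leq kn ltn_mod n0.
  have [-> ->] : (k.+1 %% n = 0 /\ k.+1 %/ n = (k %/ n).+1)%N.
    by rewrite kE kn' modnMDl divnMDl // modnn divnn n0 addn1.
  (* From the last edge back to the first: the arguments lie above - pi and at most at pi, so the
     first one plus 2 pi exceeds the last. *)
  rewrite (mulrSr (pi *+ 2) (k %/ n)); set q := _ *+ (k %/ n); rewrite mulr2n.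
  have [_ /andP[_ h1]] := argP (Wne _ (es k)); have [_ /andP[h2 _]] := argP (Wne _ (es 0%N)).
  by move: h1 h2; rewrite /e mod0n -!/(th _); lra.
- by move=> k; rewrite /e per divnDr ?dvdnn // divnn n0 addn1 mulrSr addrA.
- by move=> k; rewrite /e per.
- by move=> k; rewrite /e per.
- rewrite -[RHS]M0 -(perm_big _ (permEl (perm_sort leT s))) /= -/s' (big_nth e0) -/n.
  by apply: eq_big_nat => k /andP[_ kn]; rewrite /e modn_small.
- by move=> k; case: (WM _ (es k)).
- move=> a b /andP[ab abn]; rewrite -!(big_map e xpredT).
  apply: stable_subseq st _ _; last by move=> x /mapP[k _ ->].
  (* Indices in a window of length at most [n] are distinct modulo [n]. *)
  rewrite map_inj_in_uniq ?iota_uniq // => k l; rewrite !mem_index_iota => kab lab /eqP.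
  rewrite nth_uniq ?ltn_mod // => kl.
  wlog kl' : k l kab lab kl / (k <= l)%N.
    move=> H; have [?|/ltnW ?] := leqP k l; first exact: H.
    by apply/esym/H => //; rewrite eq_sym.
  move: kl; rewrite eq_sym eqn_mod_dvd // => nd; apply/eqP; rewrite eqn_leq kl' /= -subn_eq0.
  apply: contraLR nd; rewrite -lt0n => lk; rewrite gtnNdvd //.
  by move: kab lab abn; lia.
Qed.

End StableStar.

(** * Local variations of minimal flows *)

Section LocalVariation.
Context {R : realType} {d : nat}.
Local Notation point := (gpoint R d).
Local Notation edge := (point * point * R)%type.
Implicit Types (F : flow R d) (v z : point) (e : edge) (P : pred edge) (p : R).

Definition other v e : point := if e.1.1 == v then e.1.2 else e.1.1.
Definition outflow v e : R := if e.1.1 == v then e.2 else - e.2.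
(** Minus the gradient of the cost of [e] with respect to the position of its end [v]. *)
Definition pull p v e : point :=
  (`|e.2| `^ p / enorm (other v e - v)) *: (other v e - v).

Definition redirect v v' z : point := if z == v then v' else z.
Definition move_edge v v' P e : edge :=
  if incident v e && P e then (redirect v v' e.1.1, redirect v v' e.1.2, e.2) else e.

Definition moved_flow F v P : R := \sum_(e <- fE F | incident v e && P e) outflow v e.

(** The edge from [v] to [v'] supplies the flow of the moved edges. It is left out when that flow is
    0, since edges carry nonzero flow. *)
Definition split_flow F v v' P : flow R d :=
  Flow (v' :: fV F) (map (move_edge v v' P) (fE F) ++
    (if moved_flow F v P == 0 then [::] else [:: (v, v', moved_flow F v P)])).

Lemma split_is_flow mup mum F v v' P : is_flow mup mum F ->
  v \in fV F -> v' \notin fV F -> is_flow mup mum (split_flow F v v' P).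
Proof.
case=> uV eV pE tV bal vV v'V.
have vv' : (v == v') = false by apply/eqP => H; rewrite -H vV in v'V.
have neV z : z \in fV F -> (z == v') = false.
  by move=> zV; apply/eqP => H; rewrite -H zV in v'V.
have rV z : z \in fV F -> redirect v v' z \in v' :: fV F.
  by rewrite /redirect => zV; case: eqP => _; rewrite inE ?eqxx ?zV ?orbT.
have rI y z : y \in fV F -> z \in fV F -> (redirect v v' y == redirect v v' z) = (y == z).
  rewrite /redirect => yV zV; have [yv|yv] := eqVneq y v; have [zv|zv] := eqVneq z v => //.
  - by rewrite yv zv !eqxx.
  - by rewrite yv eq_sym neV // eq_sym (negPf zv).
  - by rewrite neV // zv (negPf yv).
split.
- by rewrite /= v'V.
- move=> e; rewrite /= mem_cat => /orP[/mapP[f fE ->]|].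
    have [f1 f2 f12 fn] := eV f fE; rewrite /move_edge; case: ifP => _ /=.
      by rewrite !rV // rI.
    by rewrite !inE f1 f2 !orbT.
  case: ifP => // m0; rewrite inE => /eqP-> /=.
  by rewrite !inE vV eqxx orbT vv' m0.
- rewrite /= pairwise_cat pairwise_map; apply/and3P; split; last by case: ifP.
    case: ifP => m0; first by apply/allrelP.
    apply/allrelP => e f /mapP[g gE ->]; rewrite inE => /eqP->.
    have [g1 g2 g12 _] := eV g gE; rewrite /same_pair /move_edge; case: ifP => gv /=.
      rewrite /redirect; case: (eqVneq g.1.1 v) => [h1|h1].
        have h2 : (g.1.2 == v) = false by rewrite -h1 eq_sym (negPf g12).
        by rewrite h2 [v' == v]eq_sym vv' h2 andbF.
      case: (eqVneq g.1.2 v) => [h2|h2]; first by rewrite (negPf h1) (neV _ g1).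
      by move: gv; rewrite /incident (negPf h1) (negPf h2).
    by rewrite (neV _ g1) (neV _ g2) andbF.
  apply: sub_in_pairwise pE => //=.
  suff H e f : e \in fE F -> f \in fE F -> ~~ same_pair e f ->
      ~~ same_pair (move_edge v v' P e) (move_edge v v' P f) by exact: H.
  move=> /eV[e1 e2 e12 _] /eV[f1 f2 f12 _]; rewrite /move_edge.
  case: ifP => [/andP[ev _]|_]; case: ifP => [/andP[fv _]|_] //.
  - by rewrite /same_pair /= !rI.
  - move=> _; rewrite /same_pair /= /redirect; case/orP: ev => /eqP ev; rewrite ev eqxx.
      by rewrite ![v' == _]eq_sym !neV.
    by rewrite ![v' == _]eq_sym !neV // !andbF.
  - move=> _; rewrite /same_pair /= /redirect; case/orP: fv => /eqP fv; rewrite fv eqxx.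
      by rewrite !neV // andbF.
    by rewrite !neV // andbF.
- by move=> z /tV zV; rewrite inE zV orbT.
- move=> z; rewrite bal /= big_cat big_map /=.
  have -> : \sum_(e <- if moved_flow F v P == 0 then [::] else [:: (v, v', moved_flow F v P)])
      e.2 * ((z == e.1.2)%:R - (z == e.1.1)%:R) =
      moved_flow F v P * ((z == v')%:R - (z == v)%:R).
    by case: eqP => [->|_]; rewrite ?big_nil ?mul0r // big_cons big_nil addr0.
  rewrite /moved_flow mulr_suml [X in _ + X]big_mkcond -big_split /= [LHS]big_seq [RHS]big_seq.
  apply: eq_bigr => e eE; have [e1 e2 e12 _] := eV e eE.
  rewrite /move_edge; case: ifP => [/andP[ev _]|_]; last by rewrite addr0.
  rewrite /redirect /outflow /=; case: (eqVneq e.1.1 v) => h1.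
    have -> : (e.1.2 == v) = false by rewrite -h1 eq_sym (negPf e12).
    by rewrite h1; ring.
  by move: ev; rewrite /incident (negPf h1) /= => /eqP->; rewrite eqxx; ring.
Qed.

(** First-order expansion of the norm with an explicit quadratic error, from (|a - b| - |a|)^2 >=
    0. *)
Lemma enormB_le (a b : point) : a != 0 ->
  enorm (a - b) <= enorm a - dot a b / enorm a + dot b b / (2 * enorm a).
Proof.
move=> a0; have ea : 0 < enorm a by rewrite lt_neqAle eq_sym enorm_eq0 a0 enorm_ge0.
have := sqr_ge0 (enorm (a - b) - enorm a).
have -> : (enorm (a - b) - enorm a) ^+ 2 =
    enorm (a - b) ^+ 2 - 2 * (enorm a * enorm (a - b)) + enorm a ^+ 2 by ring.
have -> : enorm (a - b) ^+ 2 = enorm a ^+ 2 - 2 * dot a b + dot b b.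
  by rewrite !enorm_sqr dotBl !dotBr (dotC b a); ring.
move=> h; rewrite -(ler_pM2l ea).
have -> : enorm a * (enorm a - dot a b / enorm a + dot b b / (2 * enorm a)) =
    enorm a ^+ 2 - dot a b + dot b b / 2 by field; rewrite gt_eqF.
lra.
Qed.

(** Moving the ends along [U] gains [eps * dot U U] to first order; the other two terms are the
    quadratic error and the cost of the new edge. *)
Lemma split_gilbert mup mum p F v P (eps : R) (U := \sum_(e <- fE F | incident v e && P e) pull p v e) :
  p != 0 -> is_flow mup mum F -> 0 <= eps ->
  gilbert p (split_flow F v (v + eps *: U) P) <= gilbert p F - eps * dot U U +
    eps ^+ 2 * \sum_(e <- fE F | incident v e && P e)
       `|e.2| `^ p * dot U U / (2 * enorm (other v e - v)) +
    eps * (`|moved_flow F v P| `^ p * enorm U).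
Proof.
move=> p0 [_ eV _ _ _] eps0; rewrite /gilbert /= big_cat /=; apply: lerD; last first.
  case: eqP => [->|_]; first by rewrite big_nil normr0 powR0 // mul0r mulr0.
  rewrite big_cons big_nil addr0 /= edistE opprD addrA subrr add0r.
  by rewrite enormN enormZ (ger0_norm eps0) mulrCA.
rewrite [X in _ - eps * X + _](_ : _ = \sum_(e <- fE F | incident v e && P e) dot (pull p v e) U);
  last by rewrite {1}/U dot_suml.
rewrite !mulr_sumr -sumrN.
rewrite [X in _ + X + _]big_mkcond [X in _ + _ + X]big_mkcond -!big_split /= big_map.
rewrite big_seq [leRHS]big_seq; apply: ler_sum => e eE.
have [_ _ e12 _] := eV e eE.
rewrite /move_edge; case: ifP => [/andP[ev _]|_]; last by rewrite !addr0.
pose a := other v e - v.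
have a0 : a != 0.
  rewrite subr_eq0 /other; case: (eqVneq e.1.1 v) => [h1|h1] //.
  by rewrite -h1 eq_sym.
have -> : Defs.edist e.1.1 e.1.2 = enorm a.
  rewrite edistE /a /other; case: (eqVneq e.1.1 v) => [->|h1]; first by rewrite -enormN opprB.
  by move: ev; rewrite /incident (negPf h1) /= => /eqP->.
have -> : Defs.edist (redirect v (v + eps *: U) e.1.1) (redirect v (v + eps *: U) e.1.2)
    = enorm (a - eps *: U).
  rewrite edistE /a /other /redirect; case: (eqVneq e.1.1 v) => [h1|h1].
    by rewrite -h1 eq_sym (negPf e12) -enormN opprB opprD addrA.
  by move: ev; rewrite /incident (negPf h1) /= => /eqP->; rewrite eqxx opprD addrA.
have := enormB_le (eps *: U) a0; rewrite dotZr dotZl dotZr => h.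
have ea : enorm a != 0 by rewrite enorm_eq0.
have {}h := ler_wpM2l (powR_ge0 `|e.2| p) h.
apply: le_trans h _; rewrite /= /pull -/a dotZl le_eqVlt; apply/orP; left; apply/eqP.
by field.
Qed.

Lemma minimal_stable mup mum p F v : 0 < p -> minimal_flow p mup mum F ->
  v \in fV F -> ~~ terminal mup mum v ->
  stable_star p [seq e <- fE F | incident v e] (pull p v) (outflow v).
Proof.
move=> p0 [flowF minF] vV; rewrite negb_or !negbK => /andP[/eqP mup0 /eqP mum0].
have [uV eV pE tV bal] := flowF.
have pn0 : p != 0 by rewrite gt_eqF.
have inc e : e \in fE F -> incident v e -> other v e - v != 0.
  move=> /eV[_ _ e12 _]; rewrite subr_eq0 /incident /other; case: (eqVneq e.1.1 v) => [<- _|h1 /= _] //.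
  by rewrite eq_sym.
split.
- apply/filter_uniq; apply: (pairwise_uniq (r := fun e f => ~~ same_pair e f)) pE.
  by move=> e; rewrite /same_pair !eqxx.
- move=> e; rewrite mem_filter => /andP[ev eE]; have [_ _ _ en] := eV e eE; split.
    by rewrite /outflow; case: ifP; rewrite ?oppr_eq0.
  have on := inc e eE ev.
  rewrite /pull dotZl dotZr -enorm_sqr.
  have -> : sqpow p (outflow v e) = (`|e.2| `^ p) ^+ 2.
    rewrite sqpowE mulrC powRrM powR_mulrn ?powR_ge0 //.
    by rewrite /outflow; case: ifP; rewrite ?normrN.
  by field; rewrite enorm_eq0.
- rewrite big_filter; apply/eqP; rewrite -oppr_eq0 -sumrN; apply/eqP.
  transitivity (mup v - mum v); last by rewrite mup0 mum0 subrr.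
  rewrite bal big_mkcond [LHS]big_seq [RHS]big_seq; apply: eq_bigr => e eE.
  have [_ _ e12 _] := eV e eE; rewrite /incident /outflow ![v == _]eq_sym.
  case: (eqVneq e.1.1 v) => [h1|h1] /=.
    by rewrite -h1 eq_sym (negPf e12) sub0r mulrN1.
  by case: eqP => _; rewrite ?opprK subr0 ?mulr1 ?mulr0.
move=> P; rewrite !big_filter_cond -/(moved_flow F v P).
set U := \sum_(e <- fE F | _) pull p v e.
set c := `|moved_flow F v P| `^ p.
have c0 : 0 <= c by exact: powR_ge0.
have -> : sqpow p (moved_flow F v P) = c ^+ 2.
  by rewrite sqpowE mulrC powRrM powR_mulrn ?powR_ge0.
rewrite -enorm_sqr ler_sqr ?nnegrE ?enorm_ge0 // leNgt; apply/negP => cU.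
have U0 : 0 < enorm U by rewrite (le_lt_trans c0).
pose K := \sum_(e <- fE F | incident v e && P e)
       `|e.2| `^ p * dot U U / (2 * enorm (other v e - v)).
have K0 : 0 <= K.
  apply: sumr_ge0 => e _; rewrite divr_ge0 ?mulr_ge0 ?powR_ge0 ?enorm_ge0 ?dot_ge0 //.
pose dl := dot U U - c * enorm U.
have dl0 : 0 < dl by rewrite /dl -enorm_sqr expr2 -mulrBl mulr_gt0 // subr_gt0.
(* Every [eps k] is small enough for the gain to exceed the quadratic error. Infinitely many values
   are offered, so that one of them avoids the finitely many vertices. *)
pose eps k : R := dl / (K + 1) / k.+2%:R.
have eps0 k : 0 < eps k by rewrite divr_gt0 // divr_gt0 // ltr_wpDl.
have epsK k : eps k * K < dl.
  rewrite /eps mulrAC ltr_pdivrMr // mulrAC ltr_pdivrMr ?ltr_wpDl //.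
  rewrite -mulrA ltr_pM2l // mulrDr mulr1 (@lt_le_trans _ _ (K + 1)) ?ltrDl //.
  have k1 : 1 <= k.+2%:R :> R by rewrite ler1n.
  by rewrite lerD // ler_peMl.
have [k kV] : exists k, v + eps k *: U \notin fV F.
  apply/not_existsP => H; pose s := [seq v + eps k *: U | k <- iota 0 (size (fV F)).+1].
  suff : (size s <= size (fV F))%N by rewrite size_map size_iota ltnn.
  apply: uniq_leq_size => [|x /mapP[k _ ->]]; last by have /negP := H k; rewrite negbK.
  rewrite map_inj_uniq ?iota_uniq // => i j /addrI/eqP.
  rewrite -subr_eq0 -scalerBl scaler_eq0 -enorm_eq0 (gt_eqF U0) orbF subr_eq0 => /eqP.
  have q0 : dl / (K + 1) != 0 by rewrite gt_eqF // divr_gt0 // ltr_wpDl.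
  by move/(mulfI q0)/invr_inj/eqP; rewrite eqr_nat => /eqP[].
have := minF _ (split_is_flow P flowF vV kV).
move/le_trans/(_ (@split_gilbert mup mum p F v P (eps k) pn0 flowF (ltW (eps0 k)))); rewrite -/U -/c -/K.
have := epsK k; rewrite -(ltr_pM2l (eps0 k)) /dl expr2 -mulrA.
set a := eps k * (eps k * K); rewrite mulrBr; lra.
Qed.

Lemma minimal_degree_gt1 mup mum p F v : 0 < p -> minimal_flow p mup mum F ->
  branching mup mum F v -> degree F v != 1%N.
Proof.
move=> p0 minF /andP[vV vT]; have [_ WM M0 _] := minimal_stable p0 minF vV vT.
rewrite /degree -size_filter; move: WM M0; case: [seq _ <- _ | _] => [|e [|//]] // WM.
by rewrite big_cons big_nil addr0 => M0; have [] := WM e (mem_head _ _); rewrite M0 eqxx.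
Qed.

End LocalVariation.

(** * A minimal star with d + 1 edges *)

Section FlowDecomposition.
Context {R : realType} {T : eqType} {E : finType} {n : nat}.
Variables (src tgt : E -> T) (x0 : T) (w : 'I_n -> T).
Implicit Types (cap : E -> R) (b : 'I_n -> R) (phi : T -> R).

(** Conservation in weak form, for amounts [b i] sent from [x0] to [w i]; [phi] is later an
    indicator function or a linear form. *)
Definition balanced cap b := forall phi,
  \sum_i b i * (phi (w i) - phi x0) = \sum_e cap e * (phi (tgt e) - phi (src e)).

Lemma balanced_pointwise cap b :
  (forall z, \sum_i b i * ((z == w i)%:R - (z == x0)%:R) =
     \sum_e cap e * ((z == tgt e)%:R - (z == src e)%:R)) -> balanced cap b.
Proof.
move=> H phi; pose vs := undup (x0 :: codom w ++ codom src ++ codom tgt).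
have eval y : y \in vs -> phi y = \sum_(z <- vs) phi z * (z == y)%:R.
  move=> yv; rewrite (bigD1_seq y) ?undup_uniq //= eqxx mulr1 big1 ?addr0 // => z zy.
  by rewrite (negPf zy) mulr0.
have [xv wv sv tv] : [/\ x0 \in vs, forall i, w i \in vs, forall e, src e \in vs & forall e, tgt e \in vs].
  by split=> *; rewrite mem_undup inE ?mem_cat ?codom_f ?eqxx ?orbT.
have evalB y y' : y \in vs -> y' \in vs ->
    phi y - phi y' = \sum_(z <- vs) phi z * ((z == y)%:R - (z == y')%:R).
  move=> yv y'v; rewrite (eval y) // (eval y') // -sumrB.
  by apply: eq_bigr => z _; rewrite mulrBr.
transitivity (\sum_(z <- vs) phi z * \sum_i b i * ((z == w i)%:R - (z == x0)%:R)).
  under [RHS]eq_bigr do rewrite mulr_sumr.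
  rewrite exchange_big /=; apply: eq_bigr => i _; rewrite evalB // mulr_sumr.
  by apply: eq_bigr => z _; rewrite mulrCA.
under eq_bigr do rewrite H mulr_sumr.
rewrite exchange_big /=; apply: eq_bigr => e _; rewrite evalB // mulr_sumr.
by apply: eq_bigr => z _; rewrite mulrCA.
Qed.

Definition active cap : rel T :=
  [rel x y | [exists e, [&& 0 < cap e, src e == x & tgt e == y]]].

(** On a path without repeated vertices the edges have distinct sources, so they form a set and the
    sum telescopes. *)
Lemma path_edges cap x p : path (active cap) x p -> uniq (x :: p) ->
  exists A : {set E}, (forall e, e \in A -> 0 < cap e /\ src e \in x :: p) /\
    forall phi, \sum_(e in A) (phi (tgt e) - phi (src e)) = phi (last x p) - phi x.
Proof.
elim: p x => [|y p IH] x.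
  move=> _ _; exists finset.set0; split=> [e|phi]; first by rewrite finset.in_set0.
  by rewrite finset.big_set0 subrr.
rewrite [path _ _ _]/= => /andP[/existsP[e /and3P[ce /eqP se /eqP te]] py] /andP[xp up].
have [A [A1 A2]] := IH y py up; exists (e |: A); split=> [f|phi].
  rewrite finset.in_setU1 => /predU1P[->|/A1[cf sf]]; first by rewrite se mem_head.
  by split=> //; rewrite inE sf orbT.
rewrite finset.big_setU1 /=; last by apply: contra xp => /A1[_]; rewrite se.
by rewrite A2 se te; ring.
Qed.

(** Let S be the set of vertices from which [w i] can be reached. If [x0] were outside S, the
    balance tested on the indicator of S would have a positive left side, but no active edge enters
    S from outside. *)
Lemma balanced_path cap b i : balanced cap b -> (forall e, 0 <= cap e) ->
  (forall j, 0 <= b j) -> 0 < b i ->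
  exists A : {set E}, (forall e, e \in A -> 0 < cap e) /\
    forall phi, \sum_(e in A) (phi (tgt e) - phi (src e)) = phi (w i) - phi x0.
Proof.
move=> bal cap0 b0 bi.
pose S z := exists p, path (active cap) z p /\ last z p = w i.
have [[p [pp lp]]|nS] := pselect (S x0).
  case: (shortenP pp) lp => p' pp' up' _ lp.
  by have [A [A1 A2]] := path_edges pp' up'; exists A; split=> [e /A1[]|phi] //; rewrite A2 lp.
have := bal (fun z => `[< S z >]%:R); rewrite (asboolF nS).
suff [h1 h2] : 0 < \sum_j b j * (`[< S (w j) >]%:R - 0 : R) /\
    \sum_e cap e * (`[< S (tgt e) >]%:R - `[< S (src e) >]%:R : R) <= 0.
  by move=> h; move: h1; rewrite h ltNge h2.
split.
  rewrite (bigD1 i) //= (asboolT (_ : S (w i))); last by exists [::].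
  rewrite subr0 mulr1 ltr_pwDl // sumr_ge0 // => j _.
  by rewrite subr0 mulr_ge0 // ler0n.
apply: sumr_le0 => e _; have := cap0 e; rewrite le_eqVlt => /predU1P[<-|ce].
  by rewrite mul0r.
rewrite pmulr_rle0 // subr_le0 ler_nat.
case: asboolP => // -[p [pp lp]]; rewrite asboolT //; exists (tgt e :: p); split=> //=.
by rewrite pp andbT; apply/existsP; exists e; rewrite ce !eqxx.
Qed.

(** A path to some [w i] is peeled off with the largest possible amount [a], which exhausts an edge
    or the demand [b i]; the induction is on the number of positive capacities and demands.
    Circulations may remain, hence only an inequality with [cap]. *)
Lemma flow_decomposition cap b : balanced cap b -> (forall e, 0 <= cap e) ->
  (forall j, 0 <= b j) ->
  exists t : 'I_n -> E -> R,
    [/\ forall i e, 0 <= t i e <= b i,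
        forall e, \sum_i t i e <= cap e &
        forall i phi, \sum_e t i e * (phi (tgt e) - phi (src e)) = b i * (phi (w i) - phi x0)].
Proof.
have [k] := ubnP (#|[set e | (0 < cap e)%R]| + #|[set i | (0 < b i)%R]|)%N.
elim: k cap b => // k IH cap b kE bal cap0 b0.
have [[i bi]|nb] := pselect (exists i, 0 < b i); last first.
  exists (fun _ _ => 0).
  have bz i : b i = 0.
    by apply/eqP; rewrite eq_le b0 andbT leNgt; apply/negP => bi; apply: nb; exists i.
  split=> [i e|e|i phi]; first by rewrite lexx b0.
  - by rewrite big1.
  - by rewrite bz mul0r big1 // => e _; rewrite mul0r.
have [A [A1 A2]] := balanced_path bal cap0 b0 bi.
pose a := \big[Num.min/b i]_(e in A) cap e.
have a0 : 0 < a by rewrite /a; elim/big_ind: _ => // x y hx hy; rewrite lt_min hx.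
have ab : a <= b i by exact: bigmin_le_id.
have ac e : e \in A -> a <= cap e by move=> eA; exact: bigmin_le_cond.
have aE : a = b i \/ exists2 e, e \in A & a = cap e.
  rewrite /a; elim/big_rec: _ => [|e y eA [->|[f fA ->]]]; first by left.
    by case: leP => _; [right; exists e|left].
  by case: leP => _; right; [exists e|exists f].
pose cap' e := cap e - a * (e \in A)%:R; pose b' j := b j - a * (j == i)%:R.
have cap'0 e : 0 <= cap' e.
  by rewrite /cap'; case: (boolP (e \in A)) => eA; rewrite ?mulr1 ?mulr0 ?subr0 // subr_ge0 ac.
have b'0 j : 0 <= b' j.
  by rewrite /b'; case: eqP => [->|_]; rewrite ?mulr1 ?mulr0 ?subr0 // subr_ge0.
have cap'_le e : cap' e <= cap e by rewrite gerBl mulr_ge0 ?(ltW a0) ?ler0n.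
have b'_le j : b' j <= b j by rewrite gerBl mulr_ge0 ?(ltW a0) ?ler0n.
have sum_i (F : 'I_n -> R) : \sum_j a * (j == i)%:R * F j = a * F i.
  rewrite (bigD1 i) //= eqxx mulr1 big1 ?addr0 // => j ji.
  by rewrite (negPf ji) mulr0 mul0r.
have sum_A (F : E -> R) : \sum_e a * (e \in A)%:R * F e = a * \sum_(e in A) F e.
  rewrite mulr_sumr [RHS]big_mkcond; apply: eq_bigr => e _.
  by case: ifP; rewrite ?mulr1 // mulr0 mul0r.
have bal' : balanced cap' b'.
  move=> phi; rewrite /cap' /b'.
  under eq_bigr do rewrite mulrBl; under [RHS]eq_bigr do rewrite mulrBl.
  by rewrite !sumrB bal sum_i sum_A A2.
have k' : (#|[set e | (0 < cap' e)%R]| + #|[set i | (0 < b' i)%R]| < k)%N.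
  rewrite -ltnS (leq_trans _ kE) // ltnS.
  have sA : [set e | 0 < cap' e] \subset [set e | 0 < cap e].
    by apply/fintype.subsetP => e; rewrite !finset.inE => /lt_le_trans; apply.
  have sb : [set j | 0 < b' j] \subset [set j | 0 < b j].
    by apply/fintype.subsetP => j; rewrite !finset.inE => /lt_le_trans; apply.
  case: aE => [aE|[e eA aE]].
    rewrite -addnS leq_add ?subset_leq_card // proper_card //.
    rewrite finset.properEneq sb andbT; apply/eqP => /finset.setP/(_ i).
    by rewrite !inE bi /b' eqxx mulr1 aE subrr ltxx.
  rewrite -addSn leq_add ?subset_leq_card // proper_card //.
  rewrite finset.properEneq sA andbT; apply/eqP => /finset.setP/(_ e).
  by rewrite !finset.inE (A1 _ eA) /cap' eA mulr1 aE subrr ltxx.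
have [t [t1 t2 t3]] := IH cap' b' k' bal' cap'0 b'0.
exists (fun j e => t j e + a * (j == i)%:R * (e \in A)%:R); split=> [j e|e|j phi].
- have /andP[h1 h2] := t1 j e; apply/andP; split.
    by rewrite addr_ge0 // !mulr_ge0 ?ler0n // ltW.
  rewrite -lerBrDr (le_trans h2) // lerD2l lerN2 ler_piMr ?mulr_ge0 ?ler0n ?(ltW a0) //.
  by case: (e \in A).
- by rewrite big_split /= sum_i -lerBrDr t2.
- under eq_bigr do rewrite mulrDl.
  rewrite big_split /= t3 /b'.
  have -> : \sum_e a * (j == i)%:R * (e \in A)%:R * (phi (tgt e) - phi (src e)) =
      (j == i)%:R * (a * (phi (w i) - phi x0)).
    rewrite -A2 -sum_A mulr_sumr; apply: eq_bigr => e _.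
    by rewrite [a * (j == i)%:R]mulrC !mulrA.
  by case: eqP => [->|_]; rewrite /= ?mulr1n ?mulr0n; ring.
Qed.

End FlowDecomposition.

(** * The calibrated star with d + 1 edges *)

Section SimplexStar.
Context {R : realType}.
Implicit Types (p q s u : R).

(** Young's inequality for u^q and 1 with exponents 1 / q and 1 / (1 - q). *)
Lemma powR_le_tangent q u : 0 <= q < 1 -> 0 < u -> u `^ q <= 1 - q + q * u.
Proof.
case/andP; rewrite le_eqVlt => /predU1P[<-|q0] q1 u0.
  by rewrite powRr0 mul0r subr0 addr0.
have := @conjugate_powR R (u `^ q) 1 q^-1 (1 - q)^-1 (powR_ge0 _ _) ler01.
rewrite !invrK !invr_gt0 subr_gt0 mulr1 -powRrM divff ?gt_eqF // (powRr1 (ltW u0)).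
by rewrite powR1 => /(_ q0 q1); rewrite subrKC => /(_ erefl); lra.
Qed.

(** Concavity of the power: the tangent at [s] bounds its values at 1 and at [D], and the two bounds
    are averaged. *)
Lemma powR_chord q (D s : R) : 0 <= q < 1 -> 1 < D -> 1 <= s <= D ->
  (D - s) + (s - 1) * D `^ q <= (D - 1) * s `^ q.
Proof.
move=> q01 D1 /andP[s1 sD].
have s0 : 0 < s by lra.
have D0 : 0 < D by lra.
have h1 : 1 <= s `^ q * (1 - q + q * s^-1).
  rewrite -ler_pdivrMl ?powR_gt0 // mulr1 -powRN.
  have -> : s `^ (- q) = s^-1 `^ q by rewrite -powR_inv1 ?(ltW s0) // -powRrM mulN1r.
  by apply: powR_le_tangent; rewrite ?invr_gt0.
have h2 : D `^ q <= s `^ q * (1 - q + q * (D / s)).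
  rewrite -[in leLHS](divfK (lt0r_neq0 s0) D) powRM ?(ltW s0) ?divr_ge0 ?(ltW D0) ?(ltW s0) // mulrC.
  by rewrite ler_pM2l ?powR_gt0 // powR_le_tangent // divr_gt0.
have h3 : (D - s) * 1 <= (D - s) * (s `^ q * (1 - q + q * s^-1)).
  by rewrite ler_wpM2l // subr_ge0.
have h4 : (s - 1) * D `^ q <= (s - 1) * (s `^ q * (1 - q + q * (D / s))).
  by rewrite ler_wpM2l // subr_ge0.
rewrite mulr1 in h3; apply: le_trans (lerD h3 h4) _.
rewrite le_eqVlt; apply/orP; left; apply/eqP; field.
by rewrite gt_eqF.
Qed.

Variables (d : nat) (p : R).
Hypothesis d_ge2 : (2 <= d)%N.
Hypothesis p_ge : 1 / 2 <= p.
Hypothesis p_lt1 : p < 1.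

Let D : R := d%:R.
Let D_gt1 : 1 < D. Proof. by rewrite /D ltr1n. Qed.
Let q : R := 2 * p - 1.
Let q01 : 0 <= q < 1.
Proof. by move: p_ge p_lt1 => h1 h2; rewrite /q; apply/andP; split; lra. Qed.

(* The common inner product of the [d] directions: it makes their sum have
   norm [D `^ p], which balances the edge of flow [d]. *)
Let g : R := (D `^ q - 1) / (D - 1).

Lemma g_ge0 : 0 <= g.
Proof.
rewrite divr_ge0 ?subr_ge0 ?(ltW D_gt1) // -{1}(powRr0 D) ler_powR ?(ltW D_gt1) //.
by case/andP: q01.
Qed.

Lemma g_lt1 : g < 1.
Proof.
rewrite ltr_pdivrMr ?subr_gt0 // mul1r ltrD2r -[ltRHS]powRr1; last by rewrite ltW // (lt_trans _ D_gt1).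
rewrite /powR gt_eqF ?(lt_trans _ D_gt1) // ltr_expR ltr_pM2r ?ln_gt0 //.
by case/andP: q01.
Qed.

(** The vectors [dir i] are the rows of the symmetric square root al I + be J of the Gram matrix (1
    - g) I + g J, J being the all-ones matrix; its eigenvalues are 1 - g and 1 - g + D g. *)
Let al : R := Num.sqrt (1 - g).
Let be : R := (Num.sqrt (1 - g + D * g) - al) / D.
Definition dir (i : 'I_d) : 'rV[R]_d := \row_j (al * (j == i)%:R + be).

Lemma dot_dir i j : dot (dir i) (dir j) = if i == j then 1 else g.
Proof.
have g0 := g_ge0; have g1 := g_lt1; have D1 := D_gt1.
have al2 : al ^+ 2 = 1 - g by rewrite sqr_sqrtr // subr_ge0 ltW.
have bE : D * be ^+ 2 + 2 * al * be = g.
  have s2 : Num.sqrt (1 - g + D * g) ^+ 2 = 1 - g + D * g.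
    by rewrite sqr_sqrtr // addr_ge0 ?subr_ge0 ?(ltW g1) // mulr_ge0 // ltW // (lt_trans _ D1).
  rewrite /be; move: s2 al2; set S := Num.sqrt _ => s2 al2.
  have -> : D * ((S - al) / D) ^+ 2 + 2 * al * ((S - al) / D) = (S ^+ 2 - al ^+ 2) / D.
    by field; rewrite gt_eqF // (lt_trans _ D1).
  rewrite s2 al2; field.
  by rewrite gt_eqF // (lt_trans _ D1).
have -> : dot (dir i) (dir j) = al ^+ 2 * (i == j)%:R + (D * be ^+ 2 + 2 * al * be).
  rewrite /dot; under eq_bigr do rewrite !mxE.
  have del (F : 'I_d -> R) k : \sum_l (l == k)%:R * F l = F k.
    by rewrite (bigD1 k) //= eqxx mul1r big1 ?addr0 // => l /negPf->; rewrite mul0r.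
  have -> : \sum_l (al * (l == i)%:R + be) * (al * (l == j)%:R + be) =
    al ^+ 2 * (\sum_l (l == i)%:R * (l == j)%:R) + al * be * (\sum_l (l == i)%:R * 1)
    + al * be * (\sum_l (l == j)%:R * 1) + \sum_(l < d) be ^+ 2.
    by rewrite !mulr_sumr -!big_split; apply: eq_bigr => l _ /=; ring.
  by rewrite !del sumr_const card_ord -mulr_natl -/D; ring.
by rewrite al2 bE; case: eqP => _ /=; rewrite ?mulr1n ?mulr0n; ring.
Qed.

Lemma dir_quad (t : 'I_d -> R) :
  dot (\sum_i t i *: dir i) (\sum_i t i *: dir i) =
  (1 - g) * (\sum_i t i ^+ 2) + g * (\sum_i t i) ^+ 2.
Proof.
rewrite dot_suml expr2 mulr_suml !mulr_sumr -big_split; apply: eq_bigr => i _ /=.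
rewrite dotZl dot_sumr (bigD1 i) //= dotZr dot_dir eqxx [in RHS](bigD1 i) //=.
under eq_bigr => j ji do rewrite dotZr dot_dir eq_sym (negPf ji) mulrC.
by rewrite -mulr_sumr; ring.
Qed.

(** The squared norm is (1 - g) times the sum of the t_i^2 plus g s^2. For s < 1 it is at most s^2,
    as that sum is. For s >= 1 the sum is at most s, and 1 - g + g s is the chord of s^q between 1
    and [D]. *)
Lemma dir_calibration (t : 'I_d -> R) : (forall i, 0 <= t i <= 1) ->
  enorm (\sum_i t i *: dir i) <= (\sum_i t i) `^ p.
Proof.
move=> t01; set s := \sum_i t i.
have t0 i : 0 <= t i by case/andP: (t01 i).
have s0 : 0 <= s by apply: sumr_ge0.
have p0 : 0 < p by move: p_ge; lra.
rewrite -ler_sqr ?nnegrE ?enorm_ge0 ?powR_ge0 // enorm_sqr dir_quad -/s.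
have g0 := g_ge0; have g1 := g_lt1; have D1 := D_gt1.
have E : (s `^ p) ^+ 2 = s * s `^ q.
  by rewrite -powR_mulrn ?powR_ge0 // -powRrM /q [p * _]mulrC mulr_powRB1 // mulr_gt0.
rewrite E; have [s1|s1] := leP 1 s; last first.
  have st : \sum_i t i ^+ 2 <= s ^+ 2.
    rewrite expr2 mulr_suml; apply: ler_sum => i _.
    by rewrite expr2 ler_wpM2l // /s (bigD1 i) //= lerDl sumr_ge0.
  apply: (@le_trans _ _ (s ^+ 2)).
    have : (1 - g) * \sum_i t i ^+ 2 <= (1 - g) * s ^+ 2 by rewrite ler_wpM2l // subr_ge0 ltW.
    lra.
  rewrite expr2 ler_wpM2l //; move: s0; rewrite le_eqVlt => /predU1P[<-|s0]; first exact: powR_ge0.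
  by rewrite ger1_powR ?s0 ?(ltW s1) //; case/andP: q01 => _ /ltW.
have st : \sum_i t i ^+ 2 <= s.
  by apply: ler_sum => i _; rewrite expr2 ler_piMl //; case/andP: (t01 i).
have sD : s <= D.
  rewrite /D -[d in d%:R]card_ord -sumr_const; apply: ler_sum => i _.
  by case/andP: (t01 i).
have ch : 1 - g + g * s <= s `^ q.
  rewrite -(ler_pM2l (_ : 0 < D - 1)) ?subr_gt0 //.
  apply: le_trans (powR_chord q01 D1 _); last by rewrite s1 sD.
  rewrite le_eqVlt /g; apply/orP; left; apply/eqP; field.
  by rewrite subr_eq0 gt_eqF.
have h1 : (1 - g) * \sum_i t i ^+ 2 <= (1 - g) * s by rewrite ler_wpM2l // subr_ge0 ltW.
have h2 : s * (1 - g + g * s) <= s * s `^ q by rewrite ler_wpM2l.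
lra.
Qed.

Let root : 'rV[R]_d := - \sum_i dir i.

Lemma dot_sum_dir i : dot (\sum_j dir j) (dir i) = 1 + (D - 1) * g.
Proof.
rewrite dot_suml (bigD1 i) //= dot_dir eqxx; congr (_ + _).
rewrite (eq_bigr (fun _ => g)) => [|j /negPf ji]; last by rewrite dot_dir ji.
rewrite sumr_const cardC1 card_ord -mulr_natl -subn1 natrB //.
exact: leq_trans d_ge2.
Qed.

Lemma DgE : 1 + (D - 1) * g = D `^ q.
Proof. by rewrite /g mulrC divfK ?subrKC // subr_eq0 gt_eqF. Qed.

Lemma dot_sum_sum_dir : dot (\sum_j dir j) (\sum_j dir j) = (D `^ p) ^+ 2.
Proof.
have D0 : 0 < D by rewrite (lt_trans _ D_gt1).
have p0 : 0 < p by move: p_ge; lra.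
rewrite dot_sumr (eq_bigr (fun=> D `^ q)) => [|i _]; last by rewrite dot_sum_dir DgE.
rewrite sumr_const card_ord -mulr_natl -/D.
by rewrite -powR_mulrn ?powR_ge0 // -powRrM /q [p * _]mulrC mulr_powRB1 ?(ltW D0) // mulr_gt0.
Qed.

Lemma enorm_root : enorm root = D `^ p.
Proof. by rewrite enormN /enorm dot_sum_sum_dir sqrtr_sqr ger0_norm ?powR_ge0. Qed.

Lemma enorm_dir i : enorm (dir i) = 1.
Proof. by rewrite /enorm dot_dir eqxx sqrtr1. Qed.

Lemma dir_neq0 i : dir i != 0.
Proof. by rewrite -enorm_eq0 enorm_dir oner_eq0. Qed.

Lemma dir_inj : injective dir.
Proof.
move=> i j ij; apply/eqP; apply: contraT => /negPf nij.
have := dot_dir i j; rewrite ij dot_dir eqxx nij => /eqP.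
by rewrite gt_eqF // g_lt1.
Qed.

Lemma root_neq0 : root != 0.
Proof.
by rewrite -enorm_eq0 enorm_root gt_eqF // powR_gt0 // (lt_trans _ D_gt1).
Qed.

Lemma root_neq_dir i : root != dir i.
Proof.
apply/eqP => H; have := dot_sum_dir i; rewrite DgE -[\sum_j dir j]opprK -/root H dotNl dot_dir eqxx.
by have := powR_ge0 D q; lra.
Qed.

(** The balance of a flow counts arriving mass positively, so the sinks form the positive measure
    and the root the negative one. *)
Definition simplex_source (z : 'rV[R]_d) : R := D * (z == root)%:R.
Definition simplex_sink (z : 'rV[R]_d) : R := \sum_i (z == dir i)%:R.
Definition simplex_star : flow R d :=
  Flow (0 :: root :: codom dir) ((root, 0, D) :: [seq (0, dir i, 1) | i <- enum 'I_d]).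

Lemma sink_out z : z \notin root :: codom dir -> simplex_sink z = 0 /\ simplex_source z = 0.
Proof.
rewrite inE negb_or => /andP[/negPf zr zd]; rewrite /simplex_source zr mulr0; split=> //.
by apply: big1 => i _; case: eqP zd => // ->; rewrite codom_f.
Qed.

Lemma sink_root : simplex_sink root = 0.
Proof. by apply: big1 => i _; rewrite (negPf (root_neq_dir i)). Qed.

Lemma sink_dir i : simplex_sink (dir i) = 1.
Proof.
rewrite /simplex_sink (bigD1 i) //= eqxx big1 ?addr0 // => j ji.
by rewrite (inj_eq dir_inj) eq_sym (negPf ji).
Qed.

Lemma source_dir i : simplex_source (dir i) = 0.
Proof. by rewrite /simplex_source eq_sym (negPf (root_neq_dir i)) mulr0. Qed.

Lemma root_notin : root \notin codom dir.
Proof. by apply/negP => /codomP[i /eqP]; rewrite (negPf (root_neq_dir i)). Qed.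

Lemma codom_dir_uniq : uniq (codom dir).
Proof. by rewrite map_inj_uniq ?enum_uniq //; exact: dir_inj. Qed.

Lemma simplex_data : gs_data simplex_sink simplex_source.
Proof.
have D0 : 0 <= D by rewrite ler0n.
have sup z : z \notin root :: codom dir -> simplex_sink z = 0 /\ simplex_source z = 0.
  exact: sink_out.
split; first split=> [z|]; first by apply: sumr_ge0 => i _; rewrite ler0n.
  by exists (root :: codom dir) => z /sup[].
split; first split=> [z|]; first by rewrite mulr_ge0 ?ler0n.
  by exists (root :: codom dir) => z /sup[].
exists (root :: codom dir); split => //.
  by rewrite /= root_notin codom_dir_uniq.
rewrite !big_cons sink_root !big_image /= add0r.
rewrite (eq_bigr (fun=> 1)) => [|i _]; last exact: sink_dir.
rewrite [in RHS]big1 => [|i _]; last exact: source_dir.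
by rewrite sumr_const card_ord /simplex_source eqxx mulr1 addr0.
Qed.

Lemma simplex_star_is_flow : is_flow simplex_sink simplex_source simplex_star.
Proof.
have Dn0 : D != 0 by rewrite gt_eqF // (lt_trans _ D_gt1).
have n0 i : (0 == dir i) = false by rewrite eq_sym (negPf (dir_neq0 i)).
split.
- rewrite /= inE eq_sym (negPf root_neq0) root_notin codom_dir_uniq !andbT.
  by apply/negP => /codomP[i /eqP]; rewrite n0.
- move=> e; rewrite /= inE => /predU1P[->|/mapP[i _ ->]] /=.
    by rewrite !inE !eqxx orbT root_neq0.
  by rewrite !inE codom_f !eqxx !orbT n0 oner_neq0.
- rewrite /=; apply/andP; split.
    apply/allP => e /mapP[i _ ->]; rewrite /same_pair /= (negPf root_neq0) n0.
    by rewrite (negPf (root_neq_dir i)).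
  rewrite pairwise_map; have := enum_uniq 'I_d; rewrite uniq_pairwise.
  apply: sub_pairwise => i j /= ij; by rewrite /same_pair /= eqxx n0 (inj_eq dir_inj) (negPf ij).
- move=> z; apply: contraNT => zV; rewrite /=; have [|-> ->] := @sink_out z.
    by apply: contra zV => zr; rewrite /= in_cons zr orbT.
  by rewrite subrr.
- move=> z; rewrite /= big_cons big_map /= big_enum /=.
  under [in RHS]eq_bigr do rewrite mul1r.
  by rewrite sumrB sumr_const card_ord -[_ *+ d]mulr_natl -/D /simplex_sink /simplex_source; ring.
Qed.

Lemma gilbert_simplex_star : gilbert p simplex_star = (D `^ p) ^+ 2 + D.
Proof.
rewrite /gilbert big_cons big_map /= big_enum /= edistE subr0 enorm_root ger0_norm ?ler0n // -expr2.
congr (_ + _); rewrite (eq_bigr (fun=> 1)) => [|i _].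
  by rewrite sumr_const card_ord.
by rewrite normr1 powR1 mul1r edistE sub0r enormN enorm_dir.
Qed.

Lemma simplex_star_lower_bound G : is_flow simplex_sink simplex_source G ->
  (D `^ p) ^+ 2 + D <= gilbert p G.
Proof.
case=> _ _ _ _ bal.
have p0 : 0 < p by move: p_ge; lra.
pose e (k : 'I_(size (fE G))) := tnth (in_tuple (fE G)) k.
have big_e (F : _ -> R) : \sum_(f <- fE G) F f = \sum_k F (e k) by rewrite big_tnth.
(* Edges are oriented along their flow, which makes all capacities nonnegative. *)
pose src k := if 0 <= (e k).2 then (e k).1.1 else (e k).1.2.
pose tgt k := if 0 <= (e k).2 then (e k).1.2 else (e k).1.1.
pose cap k := `|(e k).2|.
have orient (phi : 'rV[R]_d -> R) k :
    (e k).2 * (phi (e k).1.2 - phi (e k).1.1) = cap k * (phi (tgt k) - phi (src k)).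
  rewrite /cap /src /tgt; case: (leP 0 (e k).2) => h; first by rewrite ger0_norm.
  by rewrite ltr0_norm //; ring.
have bal' : balanced src tgt root dir cap (fun=> 1).
  apply: balanced_pointwise => z; rewrite -(eq_bigr _ (fun k _ => orient (fun y => (z == y)%:R) k)).
  rewrite -(big_e (fun f => f.2 * ((z == f.1.2)%:R - (z == f.1.1)%:R))) -bal.
  under eq_bigr do rewrite mul1r.
  by rewrite sumrB sumr_const card_ord -[_ *+ d]mulr_natl.
have [t [t01 tcap tdiv]] := flow_decomposition bal' (fun k => normr_ge0 _) (fun=> ler01).
(* The i-th partial flow is tested on the linear form [dot (dir i)], which yields 1 minus the inner
   product of [dir i] and the root. The sum over i is the cost of the star, and it is then compared
   with the competitor edge by edge. *)
have -> : (D `^ p) ^+ 2 + D = \sum_k dot (\sum_i t i k *: dir i) (tgt k - src k).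
  under eq_bigr do rewrite dot_suml.
  rewrite exchange_big /=.
  under eq_bigr do (under eq_bigr do rewrite dotZl dotBr; rewrite tdiv mul1r dot_dir eqxx dotNr).
  rewrite big_split /= sumr_const card_ord addrC.
  under eq_bigr do rewrite opprK.
  by rewrite -dot_suml dot_sum_sum_dir.
rewrite /gilbert big_e; apply: ler_sum => k _.
apply: le_trans (dot_le_enorm _ _) _.
have -> : enorm (tgt k - src k) = Defs.edist (e k).1.1 (e k).1.2.
  by rewrite edistE /tgt /src; case: ifP => _ //; rewrite -enormN opprB.
rewrite ler_wpM2r ?edistE ?enorm_ge0 //.
apply: le_trans (dir_calibration (fun i => t01 i k)) _.
apply: ge0_ler_powR; rewrite ?nnegrE ?(ltW p0) ?normr_ge0 //.
by apply: sumr_ge0 => i _; case/andP: (t01 i k).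
Qed.

End SimplexStar.

Theorem theorem2 (R : realType) (d : nat) (p : R) :
  (2 <= d)%N -> 0 < p < 1 ->
  ((d = 2%N \/ p < 1 / 2) ->
     forall (mup mum : gpoint R d -> R) (F : flow R d),
       gs_data mup mum -> minimal_flow p mup mum F ->
       no_deg2_branching mup mum F ->
       forall v, branching mup mum F v -> (0 < degree F v)%N ->
         degree F v = 3%N)
  /\
  (1 / 2 <= p ->
     exists (mup mum : gpoint R d -> R) (F : flow R d) (b : gpoint R d),
       [/\ gs_data mup mum, minimal_flow p mup mum F, branching mup mum F b,
           size (fE F) = d.+1 & all (incident b) (fE F)]).
Proof.
move=> d2 p01; have /andP[p0 p1] := p01; split.
  move=> dp mup mum F _ minF no2 v bv; have := no2 v bv.
  have := minimal_degree_gt1 p0 minF bv.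
  have /andP[vV vT] := bv; have st := minimal_stable p0 minF vV vT.
  (* The degrees 0, 1 and 2 are already excluded. *)
  suff : (degree F v <= 3)%N by case: degree => [|[|[|[|]]]].
  rewrite /degree -size_filter; case: dp => [dE|p2]; last exact: small_exponent_star p0 p2 st.
  by subst d; exact: planar_star p01 st.
move=> p2; exists (simplex_sink p), (@simplex_source R d p), (simplex_star d p), 0.
split.
- exact: simplex_data.
- split; first exact: simplex_star_is_flow.
  by move=> G flowG; rewrite gilbert_simplex_star //; exact: simplex_star_lower_bound.
- rewrite /branching mem_head /= /terminal negb_or !negbK.
  have [|-> ->] := @sink_out R d p 0; last by rewrite eqxx.
  rewrite inE negb_or eq_sym root_neq0 //=.
  by apply/negP => /codomP[i /esym/eqP]; rewrite (negPf (dir_neq0 d2 p2 p1 i)).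
- by rewrite /= size_map size_enum_ord.
- rewrite /= /incident /= eqxx orbT /=; apply/allP => e /mapP[i _ ->] /=.
  by rewrite eqxx.
Qed.
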